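(* Let $p$ be an odd prime, let $d$ be the multiplicative order of $2$ modulo $p$, and let $k = \frac{\phi(p)}{d}$ if $d$ is even and $k = \frac{\phi(p)}{2d}$ if $d$ is odd. Then the unitary subgroup $\mathcal{U}_*(F_2D_{2p})$ of the group algebra $F_2D_{2p}$ is the (internal) semidirect product of the normal subgroup $\mathcal{B}(F_2D_{2p})$ with the group $\langle b\rangle$. Further, there exist invertible elements $z_1,\dots,z_k$ in the center of the group algebra $F_2D_{2p}$, each of multiplicative order $2^{d/2}-1$ if $d$ is even and $2^d-1$ if $d$ is odd, such that $$\mathcal{U}(F_2D_{2p}) = \mathcal{U}_*(F_2D_{2p}) \times \prod_{i=1}^k \langle z_i\rangle$$ (internal direct product).
   Context: $\phi$ is Euler's totient function, so $\phi(p)=p-1$. $D_{2p} = \langle a, b \mid a^p = 1,\ b^2 = 1,\ b^{-1}ab = a^{-1}\rangle$ is the dihedral group of order $2p$, $F_2$ is the field with two elements, and $\mathcal{U}(F_2D_{2p})$ is the unit group of the group algebra $F_2D_{2p}$. The canonical involution $*$ of $F_2D_{2p}$ is the linear extension of $g\mapsto g^{-1}$, $g\in D_{2p}$; the unitary subgroup is $\mathcal{U}_*(F_2D_{2p}) = \{u\in\mathcal{U}(F_2D_{2p}) : u^* = u^{-1}\}$. For $g,h\in D_{2p}$ with $g$ of order $n$, put $\widehat{g} = 1+g+\cdots+g^{n-1}$; the unit $u_{g,h} = 1+(g-1)h\widehat{g}$ is called a bicyclic unit, and $\mathcal{B}(F_2D_{2p})$ is the subgroup of $\mathcal{U}(F_2D_{2p})$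 generated by all bicyclic units. *)

(* Defs.v *)
From HB Require Import structures.
From mathcomp Require Import all_boot all_order all_algebra.
From mathcomp Require Import all_fingroup all_solvable.

Set Implicit Arguments.
Unset Strict Implicit.
Unset Printing Implicit Defensive.

Import GRing.Theory.

Local Open Scope ring_scope.

(* The alias keeps the convolution product apart from the pointwise one that  *)
(* ssralg puts on finite functions.                                           *)
Definition group_algebra (R : Type) (gT : finType) : Type := {ffun gT -> R}.

Section GroupAlgebra.

Variables (R : finComNzRingType) (gT : finGroupType).

Local Notation A := (group_algebra R gT).

HB.instance Definition _ := Finite.copy A {ffun gT -> R}.
HB.instance Definition _ := GRing.Lmodule.copy A {ffun gT -> R^o}.

Implicit Types (x y z : A) (g h : gT).

Definition ga_mul x y : A :=
  [ffun g => \sum_h x h * y (h^-1 * g)%g].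

Definition ga_delta g : A := [ffun h => (h == g)%:R].

Lemma ga_mulA : associative ga_mul.
Proof.
move=> x y z; apply/ffunP=> g; rewrite !ffunE.
transitivity (\sum_k \sum_h x k * (y (k^-1 * h)%g * z (h^-1 * g)%g)).
  apply: eq_bigr => k _; rewrite ffunE mulr_sumr.
  rewrite (reindex_inj (mulgI k^-1%g)) /=.
  by apply: eq_bigr => h _; rewrite invMg invgK -!mulgA mulKVg.
rewrite exchange_big; apply: eq_bigr => h _; rewrite ffunE mulr_suml.
by apply: eq_bigr => k _; rewrite mulrA.
Qed.

Lemma ga_mul1 : left_id (ga_delta 1) ga_mul.
Proof.
move=> x; apply/ffunP=> g; rewrite ffunE (bigD1 1%g) //= ffunE eqxx mul1r.
rewrite invg1 mul1g big1 ?addr0 // => h /negPf neq_h1.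
by rewrite ffunE neq_h1 mul0r.
Qed.

Lemma ga_mulr1 : right_id (ga_delta 1) ga_mul.
Proof.
move=> x; apply/ffunP=> g; rewrite ffunE (bigD1 g) //= ffunE mulVg eqxx mulr1.
rewrite big1 ?addr0 // => h neq_hg; rewrite ffunE -eq_invg_mul invgK.
by rewrite (negPf neq_hg) mulr0.
Qed.

Lemma ga_mulDl : left_distributive ga_mul +%R.
Proof.
move=> x y z; apply/ffunP=> g; rewrite !ffunE -big_split /=.
by apply: eq_bigr => h _; rewrite ffunE mulrDl.
Qed.

Lemma ga_mulDr : right_distributive ga_mul +%R.
Proof.
move=> x y z; apply/ffunP=> g; rewrite !ffunE -big_split /=.
by apply: eq_bigr => h _; rewrite ffunE mulrDr.
Qed.

Lemma ga_1neq0 : ga_delta 1 != 0 :> A.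
Proof.
by apply/eqP=> /ffunP/(_ 1%g)/eqP; rewrite !ffunE eqxx oner_eq0.
Qed.

HB.instance Definition _ := GRing.Zmodule_isNzRing.Build A
  ga_mulA ga_mul1 ga_mulr1 ga_mulDl ga_mulDr ga_1neq0.

Lemma ga_scaleAl (c : R) x y : c *: (x * y) = (c *: x) * y.
Proof.
apply/ffunP=> g; rewrite !ffunE [LHS]mulr_sumr.
by apply: eq_bigr => h _; rewrite ffunE mulrA.
Qed.

Lemma ga_scaleAr (c : R) x y : c *: (x * y) = x * (c *: y).
Proof.
apply/ffunP=> g; rewrite !ffunE [LHS]mulr_sumr.
by apply: eq_bigr => h _; rewrite ffunE [RHS]mulrCA.
Qed.

HB.instance Definition _ := GRing.Lmodule_isLalgebra.Build R A ga_scaleAl.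
HB.instance Definition _ := GRing.Lalgebra_isAlgebra.Build R A ga_scaleAr.
(* A is finite, so being a unit is decidable and {unit A} is a finGroupType.   *)
HB.instance Definition _ := FinRing.isNzRing.Build A.

Lemma ga_delta1 : ga_delta 1 = 1.
Proof. by []. Qed.

Lemma ga_deltaM g h : ga_delta (g * h)%g = ga_delta g * ga_delta h.
Proof.
apply/ffunP=> k; rewrite !ffunE (bigD1 g) //= !ffunE eqxx mul1r.
rewrite big1 ?addr0 => [|i /negPf neq_ig]; last by rewrite ffunE neq_ig mul0r.
by rewrite -(inj_eq (mulgI g) (g^-1 * k)%g) mulKVg.
Qed.

Lemma ga_deltaX g n : ga_delta (g ^+ n)%g = ga_delta g ^+ n.
Proof. by elim: n => // n IHn; rewrite expgS exprS ga_deltaM IHn. Qed.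

Lemma ga_delta_unit g : ga_delta g \is a GRing.unit.
Proof.
apply/unitrP; exists (ga_delta g^-1%g).
by rewrite -!ga_deltaM mulVg mulgV.
Qed.

Definition ga_unit g : {unit A} := FinRing.unit A (ga_delta_unit g).

Definition ga_star x : A := \sum_g x g *: ga_delta g^-1%g.

Definition unitary : {set {unit A}} :=
  [set u | ga_star (val u) == (val u)^-1].

Definition ga_hat g : A := \sum_(i < #[g]%g) ga_delta g ^+ i.

Definition bicyclic g h : A := 1 + (ga_delta g - 1) * ga_delta h * ga_hat g.

Lemma ga_hat_subr1 g : ga_hat g * (ga_delta g - 1) = 0.
Proof.
have cgh: GRing.comm (ga_hat g) (ga_delta g - 1).
  apply/commr_sym/commr_sum => i _; apply/commrX/commr_sym.
  by apply: commrB => //; apply: commr1.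
by rewrite cgh -subrX1 -ga_deltaX expg_order subrr.
Qed.

Lemma bicyclic_is_unit g h : bicyclic g h \is a GRing.unit.
Proof.
rewrite /bicyclic; set n := _ * ga_hat g.
have nn0: n * n = 0.
  by rewrite /n !mulrA -[_ * ga_hat g * _]mulrA ga_hat_subr1 mulr0 !mul0r.
apply/unitrP; exists (1 - n).
by split; rewrite ?mulrDl ?mulrDr !(mul1r, mulr1, mulrN, mulNr, nn0, oppr0);
  rewrite ?addr0 ?addrNK ?addrK ?subrK.
Qed.

Definition bicyclic_unit g h : {unit A} :=
  FinRing.unit A (bicyclic_is_unit g h).

Definition bicyclic_group : {group {unit A}} :=
  <<[set bicyclic_unit g h | g in gT, h in gT]>>%G.

End GroupAlgebra.

Arguments unitary R%_type gT%_type : clear implicits.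
Arguments bicyclic_group R%_type gT%_type : clear implicits.

(* Main.v *)
Require Import Defs.
From HB Require Import structures.
From mathcomp Require Import all_boot all_order all_algebra.
From mathcomp Require Import all_fingroup all_solvable all_field.
From mathcomp Require Import ring zify.

(** Write F_2 D for the group algebra, R = F_2[a] for the subalgebra spanned by
    the rotations and r -> r' for the involution of R that inverts a.  Every
    element of F_2 D is u + v b with u, v in R, and b r = r' b.  A direct
    computation in characteristic two gives
      (u + v b) (u + v b)^* = u u' + v v',
    an element of the ring S of all r in R with r = r'.  Elements of S are
    central, so this norm N is multiplicative, and the unitary units are the
    units of norm 1.

    Equalities in R are checked pointwise: if L is the field with 2^d elements,
    which contains the p-th roots of unity, then an element P(a) of R is
    determined by the values P(y) for y in L with y^p = 1 (lemma [rotation_evP]).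
    On values the involution is y -> y^-1, and P(y)^2 = P(y^2).

    Splitting off the center.  Since x^(2^d) = x on L, the norm N of a unit has
    the square root c = N^(2^(d-1)) in S, and x = (x c^-1) c with x c^-1 unitary
    ([unitary_quotient]).  An element of S which is unitary has square 1, hence
    is 1 ([sym_unitary_eq1]).  So the unit group is the product of the unitary
    group with the units of S.  An element of S is determined by its values at 1
    and at one representative of each orbit of the group generated by 2 and -1
    on the nonzero residues mod p; there are k orbits and the values at their
    representatives lie in the field with 2^f elements, where f is d or d / 2.
    As S has 2^((p+1)/2) = 2 (2^f)^k elements, every choice of values is attained
    ([sym_interpolation]).  The unit z_i takes as value a generator of the
    multiplicative group of that field at the i-th representative, and 1 at the
    other ones ([central_units]).

    Bicyclic units.  They are the elements 1 + (r + r')(1 + a^i b) with r a power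
    of a, together with 1.  The unitary units acting trivially on the component
    where a = 1 form a normal complement of the group generated by b, and contain
    the bicyclic units.  To see that these generate it, let F_2 D act on R by left multiplication on the
    left ideal R (1 + b): a unitary unit u + v b sends 1 to w = u + v, and
    preserves the alternating form (r, s) -> r s' + r' s with values in S.  Products of
    bicyclic units realise all the transvections r -> r + c (r, 1) 1 and
    r -> r + c (r, a) a with c in S vanishing at y = 1 ([transvection_mem]).
    Away from y = 1 the vectors 1 and a form a hyperbolic basis, so these are the
    elementary matrices of SL_2, and the usual column reduction, four elementary
    operations on ((w, 1), (w, a)), brings w to 1 ([special_bicyclic]).  A
    unit with w = 1 in the normal complement is itself a transvection. *)

Set Implicit Arguments.
Unset Strict Implicit.
Unset Printing Implicit Defensive.

Import GRing.Theory.
Local Open Scope ring_scope.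

(** * Algebras over the field with two elements *)

Lemma F2_cases (c : 'F_2) : (c == 0) || (c == 1).
Proof. by case: c => [] [|[|[]]]. Qed.

Lemma addrr_alg2 (A : algType 'F_2) (x : A) : x + x = 0.
Proof. by rewrite -[x]scale1r -scalerDl (_ : 1 + 1 = 0) ?scale0r //; apply: val_inj. Qed.

Lemma eqr_add_alg2 (A : algType 'F_2) (x y : A) : (x + y == 0) = (x == y).
Proof.
by rewrite -(inj_eq (addIr y)) add0r -addrA addrr_alg2 addr0.
Qed.

Lemma subr_alg2 (A : algType 'F_2) (x y : A) : x - y = x + y.
Proof. by apply/eqP; rewrite subr_eq -addrA addrr_alg2 addr0. Qed.

Lemma sqrrD_alg2 (A : comAlgType 'F_2) (x y : A) : (x + y) ^+ 2 = x ^+ 2 + y ^+ 2.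
Proof. by rewrite sqrrD mulr2n addrr_alg2 addr0. Qed.

Lemma sqr_eq1_alg2 (F : fieldExtType 'F_2) (x : F) : x ^+ 2 = 1 -> x = 1.
Proof.
move/eqP; rewrite sqrf_eq1 => /orP[/eqP //|/eqP ->].
by rewrite -[LHS]add0r subr_alg2 add0r.
Qed.

(** Identities in characteristic two are often identities over the integers
    after adding a suitable [z + z] to the right-hand side; [ring] and [field]
    do not know that [2 = 0]. *)
Ltac char2 z := rewrite -[RHS]addr0 -[in RHS](addrr_alg2 z).

(** * Direct products of cyclic groups *)

Section IndependentCycles.
Local Open Scope group_scope.

Variables (gT : finGroupType) (I : finType) (z : I -> gT).

Lemma mem_prod_cycles (r : seq I) (u : gT) : uniq r ->
  u \in \prod_(i <- r) <[z i]> -> exists e : I -> nat, u = \prod_(i <- r) z i ^+ e i.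
Proof.
elim: r u => [|i r IHr] u /=.
  by rewrite big_nil => _ /set1gP->; exists (fun=> 0%N); rewrite big_nil.
case/andP=> ri /IHr{}IHr; rewrite big_cons => /imset2P[_ v /cycleP[n ->] /IHr[e ->] ->].
exists (fun j => if j == i then n else e j).
rewrite big_cons eqxx; congr (_ * _); apply: eq_big_seq => j rj.
by case: eqP rj ri => // -> ->.
Qed.

(** The second hypothesis is the form in which independence is available when
    each index has a coordinate in which the other generators are trivial. *)
Lemma dprod_cycles_free :
    (forall i j, commute (z i) (z j)) ->
    (forall i n (r : seq I) (e : I -> nat), i \notin r ->
       z i ^+ n = \prod_(j <- r) z j ^+ e j -> z i ^+ n = 1) ->
  exists G : {group gT}, \big[dprod/1]_i <[z i]> = G.
Proof.
move=> cz free_z; have: uniq (index_enum I) by apply: index_enum_uniq.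
elim: (index_enum I) => [|i r IHr] /=; first by exists 1%G; rewrite big_nil.
case/andP=> ri Ur; case: (IHr Ur) => G defG; rewrite big_cons defG.
have mem_G u := @mem_prod_cycles r u Ur; rewrite (bigdprodW defG) in mem_G.
exists (<[z i]> <*> G)%G; apply: dprodEY.
  apply/subsetP=> u /mem_G[e ->]; rewrite cent_cycle; apply/cent1P.
  by apply/commute_sym/commute_prod => j _; apply: commuteX.
apply/trivgP/subsetP=> _ /setIP[/cycleP[n ->] /mem_G[e def_u]]; apply/set1gP.
exact: free_z ri def_u.
Qed.

End IndependentCycles.

(** * Finite fields and the multiplicative order of two *)

Lemma finField_prim_root (F : finFieldType) : exists w : F, (#|F| - 1).-primitive_root w.
Proof.
have F_gt1 := card_finNzRing_gt1 F.
pose rs := [seq x : F <- enum F | x != 0].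
suff /hasP[w _ w_prim] : has (#|F| - 1).-primitive_root rs by exists w.
apply: has_prim_root => //; first by rewrite subn_gt0.
- apply/allP=> x; rewrite mem_filter unity_rootE => /andP[nzx _]; apply/eqP.
  by apply: (mulIf nzx); rewrite mul1r -exprSr subn1 (ltn_predK F_gt1) expf_card.
- by rewrite filter_uniq ?enum_uniq.
rewrite size_filter -(leq_add2l (count (pred1 0) (enum F))).
rewrite (eq_count (_ : predC1 0 =1 predC (pred1 0))) // count_predC -cardE.
rewrite -[leqRHS](subnKC (ltnW F_gt1)) leq_add2r.
by rewrite count_uniq_mem ?enum_uniq ?leq_b1.
Qed.

Lemma field_order_2X d : (0 < d)%N -> exists L : fieldExtType 'F_2,
  (forall x : L, x ^+ (2 ^ d) = x) /\ exists w : L, (2 ^ d - 1).-primitive_root w.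
Proof.
move=> d_gt0; have [F ch2 oF] := @pPrimePowerField 2 d isT d_gt0.
exists (pPrimeCharType ch2); rewrite -oF; split=> [x|]; first exact: (@expf_card F x).
by have [w] := finField_prim_root F; exists w.
Qed.

Lemma order_two_unity_root p d (L : fieldExtType 'F_2) : prime p -> odd p ->
    d.-primitive_root (2%:R : 'F_p) ->
    (exists w : L, (2 ^ d - 1).-primitive_root w) ->
  exists zeta : L, p.-primitive_root zeta.
Proof.
move=> p_pr p_odd two_prim [w w_prim].
exists (w ^+ ((2 ^ d - 1) %/ p)%N); apply: dvdn_prim_root => //.
rewrite (dvdn_pcharf (pchar_Fp p_pr)) natrB ?expn_gt0 // natrX.
by rewrite (prim_expr_order two_prim) subrr.
Qed.

(** The subgroup of nonzero residues mod [p] generated by 2 and -1 has order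
    [2 * sym_degree d]; accordingly [sym_degree d] is the degree over the field
    with two elements of the field generated by [zeta + zeta^-1], for [zeta] a
    primitive [p]-th root of unity. *)
Definition sym_degree (d : nat) := (if odd d then d else d %/ 2)%N.

(** The index of that subgroup. *)
Definition num_orbits (p d : nat) :=
  (if odd d then totient p %/ (2 * d) else totient p %/ d)%N.

Section OrderOfTwo.

Variables p d : nat.
Hypotheses (p_pr : prime p) (p_odd : odd p) (two_prim : d.-primitive_root (2%:R : 'F_p)).

Local Notation k := (num_orbits p d).
Local Notation f := (sym_degree d).

Let Fp_nat0 n : (n%:R == 0 :> 'F_p) = (p %| n)%N.
Proof. by rewrite (dvdn_pcharf (pchar_Fp p_pr)). Qed.

Let Fp_X (x : 'F_p) : x != 0 -> x ^+ p.-1 = 1.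
Proof.
move=> nzx; apply: (mulIf nzx); rewrite mul1r -exprSr prednK ?prime_gt0 //.
by have := expf_card x; rewrite card_Fp.
Qed.

Lemma order_two_dvd : (d %| p.-1)%N.
Proof.
rewrite (prim_order_dvd two_prim) Fp_X // Fp_nat0.
by apply/negP=> /(dvdn_leq (isT : 0 < 2)%N); have := odd_prime_gt2 p_odd p_pr; lia.
Qed.

Lemma half_order_two_card : p.-1 = (2 * f * k)%N.
Proof.
have d_gt0 := prim_order_gt0 two_prim.
have dvd_d := order_two_dvd; rewrite /sym_degree /num_orbits totient_prime //.
have dvd_2: (2 %| p.-1)%N by have := prime_gt0 p_pr; lia.
case: ifP => od.
  by rewrite [RHS]mulnC divnK // Gauss_dvd ?dvd_2 // coprime2n.
by rewrite [(2 * _)%N]mulnC divnK ?dvdn2 ?od // mulnC divnK.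
Qed.

(** For even [d], the residue of [2 ^ (d / 2)] is a square root of 1 other than 1,
    hence -1. *)
Lemma half_order_two_neg : ~~ odd d -> (p %| (2 ^ f).+1)%N.
Proof.
move=> ev; have d_gt0 := prim_order_gt0 two_prim; rewrite /sym_degree (negPf ev).
rewrite -Fp_nat0 -natr1 natrX addr_eq0.
have: (2%:R ^+ (d %/ 2)%N) ^+ 2 == 1 :> 'F_p.
  by rewrite -exprM divnK ?dvdn2 // (prim_expr_order two_prim).
rewrite sqrf_eq1 => /orP[|//]; rewrite -(prim_order_dvd two_prim) => /dvdn_leq.
by move=> H; have := H ltac:(lia); lia.
Qed.

Let half_power (x : 'F_p) : x ^+ (2 * f) = 1 -> exists s, x = 2%:R ^+ s \/ x = - 2%:R ^+ s.
Proof.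
have two_pow (y : 'F_p) : y ^+ d = 1 -> exists s, y = 2%:R ^+ s.
  by case/(prim_rootP two_prim) => s ->; exists s.
rewrite /sym_degree; case: ifP => od; last first.
  by rewrite mulnC divnK ?dvdn2 ?od // => /two_pow[s ->]; exists s; left.
move/eqP; rewrite mulnC exprM sqrf_eq1 => /orP[]/eqP xd.
  by have [s ->] := two_pow _ xd; exists s; left.
have [|s def_x] := two_pow (- x); last by exists s; right; rewrite -def_x opprK.
by rewrite exprNn -signr_odd od xd mulrNN mulr1.
Qed.

(** If [g] is a primitive root mod [p], then the powers of [g] whose exponent is
    less than the index [k] represent the cosets of the subgroup generated by
    2 and -1, because a cyclic group has one subgroup of each order. *)
Lemma residue_orbits : exists g, forall j, ~~ (p %| j)%N ->
  exists (i : 'I_k) s,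
    (j == 2 ^ s * g ^ i %[mod p])%N \/ (p %| j + 2 ^ s * g ^ i)%N.
Proof.
have [g] := finField_prim_root 'F_p; rewrite card_Fp // subn1 => g_prim.
have k_gt0 : (0 < k)%N.
  by have := half_order_two_card; have := odd_prime_gt2 p_odd p_pr; case: k; lia.
exists g => j; rewrite -Fp_nat0 => /Fp_X/(prim_rootP g_prim)[e def_j].
exists (Ordinal (ltn_pmod e k_gt0)) => /=.
(* The exponent of j is e = i + l k, and g^(l k) is a root of x^(2 f) = 1. *)
have [|s gs] := @half_power (g ^+ (e %/ k * k)%N).
  by rewrite -exprM -mulnA [(k * _)%N]mulnC -half_order_two_card mulnC exprM
     (prim_expr_order g_prim) expr1n.
exists s; rewrite (divn_eq e k) exprD in def_j.
have nat_g : (nat_of_ord g)%:R = g by exact: natr_Zp.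
case: gs => gs; rewrite gs in def_j.
  left; apply/eqP; rewrite -!(val_Fp_nat p_pr) def_j; congr (nat_of_ord _).
  by rewrite natrM !natrX nat_g.
by right; rewrite -Fp_nat0 natrD natrM !natrX nat_g def_j mulNr addNr.
Qed.

End OrderOfTwo.

(** * Values of polynomials at roots of unity *)

Lemma horner_alg_comp (K : comNzRingType) (A : algType K) (x : A) (P Q : {poly K}) :
  horner_alg x (P \Po Q) = horner_alg (horner_alg x Q) P.
Proof.
elim/poly_ind: P => [|P c IHP]; first by rewrite comp_poly0 !rmorph0.
by rewrite comp_poly_MXaddC !rmorphD !rmorphM /= IHP !horner_algC horner_algX.
Qed.

(** The coefficients lie in the field with two elements and are fixed by
    squaring. *)
Lemma horner_alg_sqr (A : comAlgType 'F_2) (x : A) (P : {poly 'F_2}) :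
  horner_alg x P ^+ 2 = horner_alg (x ^+ 2) P.
Proof.
elim/poly_ind: P => [|P c IHP]; first by rewrite !rmorph0 expr0n.
rewrite !rmorphD !rmorphM /= !horner_algC !horner_algX sqrrD_alg2 exprMn IHP.
by congr (_ + _); case/orP: (F2_cases c) => /eqP->; rewrite ?scale0r ?scale1r ?expr0n ?expr1n.
Qed.

Lemma horner_alg_sqrX (A : comAlgType 'F_2) (x : A) (P : {poly 'F_2}) s :
  horner_alg x P ^+ (2 ^ s) = horner_alg (x ^+ (2 ^ s)) P.
Proof. by elim: s x => [|s IHs] x //; rewrite expnS !exprM horner_alg_sqr IHs. Qed.

(** This lifts to polynomials the involution of the group algebra of a cyclic
    group of order [p] that inverts the generator.  It is locked because the
    unifier would otherwise unfold composition. *)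
HB.lock Definition inv_poly (p : nat) (P : {poly 'F_2}) : {poly 'F_2} := P \Po 'X^(p.-1).

Section InvPoly.

Variable p : nat.
Implicit Types P Q : {poly 'F_2}.

Lemma inv_poly0 : inv_poly p 0 = 0.
Proof. by rewrite unlock comp_poly0. Qed.

Lemma inv_polyD P Q : inv_poly p (P + Q) = inv_poly p P + inv_poly p Q.
Proof. by rewrite unlock comp_polyD. Qed.

Lemma inv_poly_MXaddC P c : inv_poly p (P * 'X + c%:P) = inv_poly p P * 'X^(p.-1) + c%:P.
Proof. by rewrite unlock comp_poly_MXaddC. Qed.

End InvPoly.

Section Evaluation.

Variables (p d : nat) (L : fieldExtType 'F_2).
Hypotheses (p_pr : prime p) (p_odd : odd p).
Hypotheses (two_prim : d.-primitive_root (2%:R : 'F_p)).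
Hypothesis L_frob : forall x : L, x ^+ (2 ^ d) = x.

Local Notation ev := (@horner_alg 'F_2 L).

Definition sym_poly P := forall y : L, y ^+ p = 1 -> ev y^-1 P = ev y P.

Lemma unity_root_neq0 (y : L) : y ^+ p = 1 -> y != 0.
Proof.
by apply: contra_eq_neq => ->; rewrite expr0n gtn_eqF ?prime_gt0 //= eq_sym oner_eq0.
Qed.

Lemma unity_root_inv (y : L) i : y ^+ p = 1 -> (i <= p)%N -> y^-1 ^+ i = y ^+ (p - i).
Proof.
move=> yp le_ip; have nzy := unity_root_neq0 yp.
by apply: (mulIf (expf_neq0 i nzy)); rewrite -exprMn mulVf // expr1n -exprD subnK.
Qed.

Lemma ev_inv_poly (y : L) P : y ^+ p = 1 -> ev y (inv_poly p P) = ev y^-1 P.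
Proof.
move=> yp; rewrite unlock horner_alg_comp rmorphXn /= horner_algX -subn1.
by rewrite -unity_root_inv ?prime_gt0.
Qed.

Lemma ev1_inv_poly P : ev 1 (inv_poly p P) = ev 1 P.
Proof. by rewrite ev_inv_poly ?expr1n ?invr1. Qed.

Lemma ev1_F2 P : (ev 1 P == 0) || (ev 1 P == 1).
Proof.
elim/poly_ind: P => [|P c IHP]; first by rewrite rmorph0 eqxx.
rewrite rmorphD rmorphM /= horner_algC horner_algX mulr1.
case/orP: (F2_cases c) => /eqP->; rewrite ?scale0r ?addr0 // scale1r eqr_add_alg2 orbC.
by rewrite -[_ + 1 == 1]subr_eq0 addrK.
Qed.

Variable zeta : L.
Hypothesis zeta_prim : p.-primitive_root zeta.

Lemma ev_small_poly0 (P : {poly 'F_2}) : (size P <= p)%N ->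
  (forall y : L, y ^+ p = 1 -> ev y P = 0) -> P = 0.
Proof.
move=> szP P0; apply/eqP; rewrite -(map_poly_eq0 (in_alg L)); apply/eqP.
apply: contraTeq szP => nzP; rewrite -ltnNge -(size_map_poly (in_alg L) P).
have := @max_poly_roots _ _ [seq zeta ^+ (i : 'I_p) | i : 'I_p] nzP.
rewrite size_map -cardE card_ord; apply.
  apply/allP=> _ /mapP[i _ ->]; apply/eqP; apply: P0.
  by rewrite exprAC (prim_expr_order zeta_prim) expr1n.
rewrite map_inj_uniq ?enum_uniq // => i j /eqP.
by rewrite (eq_prim_root_expr zeta_prim) !modn_small // => /eqP/val_inj.
Qed.

(** Both conditions say that [X^p - 1] divides [P]. *)
Lemma horner_alg_eq0P (A : algType 'F_2) (x : A) (P : {poly 'F_2}) : x ^+ p = 1 ->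
    (forall Q : {poly 'F_2}, (size Q <= p)%N -> horner_alg x Q = 0 -> Q = 0) ->
  horner_alg x P = 0 <-> (forall y : L, y ^+ p = 1 -> ev y P = 0).
Proof.
move=> xp x_free; pose M : {poly 'F_2} := 'X^p - 1.
have Mz (B : algType 'F_2) (y : B) : y ^+ p = 1 -> horner_alg y M = 0.
  by move=> yp; rewrite rmorphB rmorph1 rmorphXn /= horner_algX yp subrr.
have hornerE (B : algType 'F_2) (y : B) : y ^+ p = 1 ->
    horner_alg y P = horner_alg y (P %% M).
  by move=> yp; rewrite {1}(divp_eq P M) rmorphD rmorphM /= Mz // mulr0 add0r.
have szM : (size (P %% M)%R <= p)%N.
  have sM: size M = p.+1 by rewrite size_XnsubC ?prime_gt0.
  by rewrite -ltnS -sM ltn_modp -size_poly_eq0 sM.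
split=> P0.
  by move=> y yp; rewrite hornerE // (x_free _ szM) ?rmorph0 // -hornerE.
rewrite hornerE // (ev_small_poly0 szM) ?rmorph0 // => y yp.
by rewrite -hornerE // P0.
Qed.

Local Notation k := (num_orbits p d).
Local Notation f := (sym_degree d).

(** For even [d], raising to the power [2 ^ f] inverts the [p]-th roots of
    unity. *)
Lemma sym_value P (x : L) : sym_poly P -> x ^+ p = 1 -> ev x P ^+ (2 ^ f) = ev x P.
Proof.
move=> sP xp; have := half_order_two_neg p_pr p_odd two_prim.
have [od _|/negbTE ev_d /(_ isT) /dvdnP[q def_f]] := boolP (odd d).
  by rewrite /sym_degree od L_frob.
rewrite horner_alg_sqrX -sP //; congr (ev _ P).
apply: (mulIf (unity_root_neq0 xp)); rewrite mulVf ?unity_root_neq0 // -exprSr.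
by rewrite def_f mulnC exprM xp expr1n.
Qed.

Definition sym_separating (y : 'I_k -> L) :=
  (forall i, y i ^+ p = 1) /\
  forall P Q, sym_poly P -> sym_poly Q -> ev 1 P = ev 1 Q ->
    (forall i, ev (y i) P = ev (y i) Q) ->
  forall x : L, x ^+ p = 1 -> ev x P = ev x Q.

(** A symmetric polynomial takes the same value at [x] and [x^-1], and its value
    at [x ^+ (2 ^ s)] is a power of its value at [x]: one point in each orbit of
    the group generated by 2 and -1 acting on exponents is enough. *)
Lemma sym_representatives : exists y, sym_separating y.
Proof.
have [g orb] := residue_orbits p_pr p_odd two_prim.
exists (fun i : 'I_k => zeta ^+ (g ^ i)); split=> [i|P Q sP sQ PQ1 PQ x xp].
  by rewrite exprAC (prim_expr_order zeta_prim) expr1n.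
have [j ->] := prim_rootP zeta_prim xp.
have [p_j|/orb[i [s orb_j]]] := boolP (p %| j)%N.
  by have/eqP-> : zeta ^+ j == 1; first by rewrite -(prim_order_dvd zeta_prim).
have yp : (zeta ^+ (2 ^ s * g ^ i)) ^+ p = 1.
  by rewrite exprAC (prim_expr_order zeta_prim) expr1n.
suff PQy: ev (zeta ^+ (2 ^ s * g ^ i)) P = ev (zeta ^+ (2 ^ s * g ^ i)) Q.
  case: orb_j => orb_j.
    have/eqP-> // : zeta ^+ j == zeta ^+ (2 ^ s * g ^ i).
    by rewrite (eq_prim_root_expr zeta_prim).
  rewrite (_ : zeta ^+ j = (zeta ^+ (2 ^ s * g ^ i))^-1) ?sP ?sQ //.
  apply: (mulIf (unity_root_neq0 yp)); rewrite mulVf ?unity_root_neq0 // -exprD.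
  by apply/eqP; rewrite -(prim_order_dvd zeta_prim).
by rewrite mulnC exprM -!horner_alg_sqrX PQ.
Qed.

(** This is a counting argument.  The symmetric polynomials [F h] below are
    distinct modulo [X^p - 1] and there are [2 ^ (n + 1)] of them, where
    [p = 2 n + 1].  Their values at 1 and at the points [y i] determine them, and
    lie in a set with [2 * (2 ^ f) ^ k = 2 ^ (n + 1)] elements. *)
Lemma sym_interpolation (y : 'I_k -> L) (gamma : L) :
    (2 ^ f - 1).-primitive_root gamma -> sym_separating y ->
  forall t : 'I_k -> L, (forall i, t i ^+ (2 ^ f) = t i) ->
  exists P, [/\ sym_poly P, ev 1 P = 1 & forall i, ev (y i) P = t i].
Proof.
move=> gamma_prim [yp y_sep] t t_f; set m := (2 ^ f - 1)%N in gamma_prim.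
have m1 : m.+1 = (2 ^ f)%N by rewrite /m subn1 prednK ?expn_gt0.
have m_gt0 := prim_order_gt0 gamma_prim.
(* L carries no finite type structure, so the solutions of x^(2^f) = x are
   counted through their codes. *)
pose dec (o : option 'I_m) := if o is Some e then gamma ^+ e else 0.
have decP (x : L) : x ^+ (2 ^ f) = x -> exists o, dec o = x.
  have [->|nzx] := eqVneq x 0; first by exists None.
  rewrite -m1 exprSr => /(canRL (mulfK nzx)); rewrite divff //.
  by case/(prim_rootP gamma_prim)=> e ->; exists (Some e).
pose n := p./2; have def_p : p = (n + n).+1 by rewrite /n; lia.
pose G (i : 'I_n) : {poly 'F_2} := 'X^(i.+1) + 'X^(p - i.+1).
pose F (h : {ffun 'I_n.+1 -> 'F_2}) : {poly 'F_2} :=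
  (h ord0)%:P + \sum_(i < n) h (lift ord0 i) *: G i.
have szF h : (size (F h) <= p)%N.
  apply: (leq_trans (size_polyD _ _)); rewrite geq_max.
  rewrite (leq_trans (size_polyC_leq1 _)) ?prime_gt0 //=.
  apply: (leq_trans (size_sum _ _ _)); apply/bigmax_leqP=> i _.
  apply: (leq_trans (size_scale_leq _ _)); apply: (leq_trans (size_polyD _ _)).
  by rewrite geq_max !size_polyXn; have := ltn_ord i; lia.
have symG i : sym_poly (G i).
  move=> x xp; rewrite !rmorphD !rmorphXn /= !horner_algX.
  have := ltn_ord i => lt_in.
  by rewrite !unity_root_inv ?subKn 1?addrC //; lia.
have symF h : sym_poly (F h).
  move=> x xp; rewrite !rmorphD !rmorph_sum /= !horner_algC; congr (_ + _).
  by apply: eq_bigr => i _; rewrite !linearZ /= symG.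
have coefG (i : 'I_n) (j : nat) : (j <= n)%N -> (G i)`_j = (j == i.+1)%:R.
  move=> le_jn; rewrite coefD !coefXn; have lt_in := ltn_ord i.
  by rewrite (_ : j == (p - i.+1)%N = false) ?addr0 //; lia.
have coefF h (i : 'I_n.+1) : (F h)`_i = h i.
  rewrite coefD coefC coef_sum; case: (unliftP ord0 i) => [j|] ->.
    rewrite add0r (bigD1 j) //= big1 => [|j' neq_j'].
      by rewrite addr0 coefZ coefG ?lift0 ?eqxx ?mulr1.
    by rewrite coefZ coefG ?lift0 // eqSS eq_sym (inj_eq val_inj) (negPf neq_j') mulr0.
  by rewrite big1 ?addr0 // => j _; rewrite coefZ coefG // mulr0.
have ev1F h : exists c : 'F_2, c%:A == ev 1 (F h).
  by case/orP: (ev1_F2 (F h)) => /eqP->; [exists 0; rewrite scale0r | exists 1; rewrite scale1r].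
have evyF h i : exists o, dec o == ev (y i) (F h).
  by have [o <-] := decP _ (sym_value (symF h) (yp i)); exists o.
pose Th h : 'F_2 * {ffun 'I_k -> option 'I_m} :=
  (xchoose (ev1F h), [ffun i => xchoose (evyF h i)]).
have injTh : injective Th.
  move=> h h' [E1 /ffunP E2].
  have FF : F h = F h'.
    apply/eqP; rewrite -subr_eq0; apply/eqP; apply: ev_small_poly0.
      by rewrite (leq_trans (size_polyD _ _)) // size_polyN geq_max !szF.
    move=> x xp; rewrite rmorphB; apply/eqP; rewrite subr_eq0; apply/eqP.
    apply: y_sep xp => // [|i].
      by rewrite -(eqP (xchooseP (ev1F h))) -(eqP (xchooseP (ev1F h'))) E1.
    have := E2 i; rewrite !ffunE => {}E2.
    by rewrite -(eqP (xchooseP (evyF h i))) -(eqP (xchooseP (evyF h' i))) E2.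
  by apply/ffunP=> i; rewrite -!coefF FF.
have cardTh : (#|{: 'F_2 * {ffun 'I_k -> option 'I_m}}| <= #|{ffun 'I_n.+1 -> 'F_2}|)%N.
  rewrite card_prod !card_ffun card_option card_Fp // !card_ord m1 expnS leq_mul2l /=.
  rewrite -expnM leq_exp2l //.
  have := half_order_two_card p_pr p_odd two_prim; rewrite def_p /= addnn -muln2.
  by rewrite mulnC -mulnA => /eqP; rewrite eqn_pmul2l // => /eqP <-.
have td i : exists o, dec o == t i.
  by have [o <-] := decP _ (t_f i); exists o.
have /codomP[h] := inj_card_onto injTh cardTh (1, [ffun i => xchoose (td i)]).
case=> E1 /ffunP E2; exists (F h); split=> //.
  by rewrite -(eqP (xchooseP (ev1F h))) -E1 scale1r.
move=> i; have := E2 i; rewrite !ffunE => {}E2.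
by rewrite -(eqP (xchooseP (evyF h i))) -E2 (eqP (xchooseP (td i))).
Qed.

End Evaluation.

(** * The canonical involution and the unitary subgroup *)

Section Star.

Variables (R : finComNzRingType) (gT : finGroupType).
Local Notation A := (group_algebra R gT).
Implicit Types (x y : A) (g h : gT).

Lemma ga_sum x : x = \sum_g x g *: ga_delta R g.
Proof.
apply/ffunP=> h; rewrite sum_ffunE (bigD1 h) //= !ffunE eqxx big1 => [|g /negPf neq_gh].
  by rewrite addr0 [RHS]mulr1.
by rewrite !ffunE eq_sym neq_gh; apply: mulr0.
Qed.

Lemma ga_mul_delta x g h : (x * ga_delta R g) h = x (h * g^-1)%g.
Proof.
rewrite ffunE (bigD1 (h * g^-1)%g) //= ffunE invMg invgK -mulgA mulVg mulg1 eqxx mulr1.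
rewrite big1 ?addr0 // => i neq_i; rewrite ffunE [_ == _](_ : _ = false) ?mulr0 //.
by apply: contraNF neq_i => /eqP<-; rewrite invMg invgK mulKVg.
Qed.

Lemma ga_starE x g : ga_star x g = x g^-1%g.
Proof.
rewrite /ga_star sum_ffunE (bigD1 g^-1%g) //= !ffunE invgK eqxx big1 => [|h neq_h].
  by rewrite addr0 [LHS]mulr1.
rewrite !ffunE [_ == _](_ : _ = false); first exact: mulr0.
by apply: contraNF neq_h => /eqP->; rewrite invgK.
Qed.

Lemma ga_starD x y : ga_star (x + y) = ga_star x + ga_star y.
Proof. by apply/ffunP=> g; rewrite !(ga_starE, ffunE). Qed.

Lemma ga_star_delta g : ga_star (ga_delta R g) = ga_delta R g^-1%g.
Proof. by apply/ffunP=> h; rewrite ga_starE !ffunE -eqg_inv invgK. Qed.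

Lemma ga_star_alg c : ga_star (c%:A : A) = c%:A.
Proof. by apply/ffunP=> h; rewrite ga_starE !ffunE invg_eq1. Qed.

Lemma ga_starM x y : ga_star (x * y) = ga_star y * ga_star x.
Proof.
apply/ffunP=> g; rewrite ga_starE !ffunE [RHS](reindex_inj (mulgI g)) /=.
by apply: eq_bigr => h _; rewrite !ga_starE !invMg !invgK mulKg mulrC.
Qed.

Lemma ga_star1 : ga_star 1 = 1 :> A.
Proof. by rewrite -(scale1r 1) ga_star_alg. Qed.

Lemma unitary_mulP (u : {unit A}) : reflect (ga_star (val u) * val u = 1) (u \in unitary R gT).
Proof.
rewrite inE -(inj_eq (mulIr (valP u))) mulVr ?(valP u) //.
exact: eqP.
Qed.

Lemma unitary_mulVP (u : {unit A}) : reflect (val u * ga_star (val u) = 1) (u \in unitary R gT).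
Proof.
rewrite inE -(inj_eq (mulrI (valP u))) mulrV ?(valP u) //.
exact: eqP.
Qed.

Lemma unitary_group_set : group_set (unitary R gT).
Proof.
apply/group_setP; split=> [|u v /unitary_mulP Uu /unitary_mulP Uv].
  by apply/unitary_mulP; rewrite ga_star1 mulr1.
by apply/unitary_mulP; rewrite ga_starM -mulrA [X in _ * X]mulrA Uu mul1r.
Qed.

Canonical unitary_group := Group unitary_group_set.

End Star.

(** * Coordinates on the dihedral group algebra *)

Section DihedralRelations.

Local Open Scope group_scope.
Variables (gT : finGroupType) (p : nat) (a b : gT).
Hypotheses (p_pr : prime p) (card_gT : #|gT| = p.*2).
Hypotheses (gen_ab : <<[set a; b]>> = [set: gT]).
Hypotheses (ap : a ^+ p = 1) (b2 : b ^+ 2 = 1) (ab : a ^ b = a^-1).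

Let cycles_ab : <[a]> * <[b]> = [set: gT].
Proof.
have nab: <[b]> \subset 'N(<[a]>).
  by rewrite cycle_subG /= -cycle_subG norms_cycle ab groupV cycle_id.
rewrite -gen_ab -norm_joinEr // joingE; apply/eqP; rewrite eqEsubset !gen_subG.
rewrite !subUset !cycle_subG !sub1set.
by rewrite !mem_gen ?inE ?eqxx ?orbT ?cycle_id ?orbT.
Qed.

(** The orders of [a] and [b] divide [p] and 2, while the product of the subgroups
    they generate is the whole group, which has [2 * p] elements. *)
Lemma dihedral_orders : #[a] = p /\ b \notin <[a]>.
Proof.
have dvd_a : (#[a] %| p)%N by rewrite order_dvdn ap.
have dvd_b : (#[b] %| 2)%N by rewrite order_dvdn b2.
have le_a := dvdn_leq (prime_gt0 p_pr) dvd_a; have le_b := dvdn_leq (isT : 0 < 2)%N dvd_b.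
have := mul_cardG <[a]> <[b]>; rewrite cycles_ab cardsT card_gT -!orderE => E.
have : (0 < #|<[a]> :&: <[b]>|)%N by apply: cardG_gt0.
have p0 := prime_gt0 p_pr; have a0 := order_gt0 a; have b0 := order_gt0 b.
have le_ab : (#[a] * #[b] <= p * 2)%N by apply: leq_mul.
move: (leq_trans (eq_leq (esym E)) le_ab).
rewrite -muln2 -[leqRHS]muln1 leq_pmul2l ?muln_gt0 ?p0 // => I_le1 I_gt0.
have I1: #|<[a]> :&: <[b]>| = 1%N by apply/eqP; rewrite eqn_leq I_le1.
rewrite I1 in E; split; first by nia.
apply/negP=> ba; have /eqP := I1; rewrite -trivg_card1 => /eqP I1'.
have : b \in <[a]> :&: <[b]> by rewrite inE ba cycle_id.
rewrite I1' => /set1gP b1; move: E; rewrite b1 order1; nia.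
Qed.

Lemma dihedral_elt g : exists i, g = a ^+ i \/ g = a ^+ i * b.
Proof.
have := in_setT g; rewrite -cycles_ab => /imset2P[_ _ /cycleP[i ->] /cycleP[j ->] ->].
exists i; rewrite -(odd_double_half j) -mul2n expgD expgM b2 expg1n mulg1.
by case: (odd j); [right; rewrite expg1 | left; rewrite mulg1].
Qed.

End DihedralRelations.

(** Evaluation of polynomials at [a] in the group algebra.  It is locked because
    the unifier would otherwise unfold the convolution product. *)
HB.lock Definition rotation (gT : finGroupType) (a : gT) (P : {poly 'F_2}) :
  group_algebra 'F_2 gT := horner_alg (ga_delta 'F_2 a) P.

Section Rotation.
Variables (gT : finGroupType) (a : gT).

Lemma rotationE P : rotation a P = horner_alg (ga_delta _ a) P.
Proof. by rewrite unlock. Qed.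

Let rotation_zmod : zmod_morphism (rotation a).
Proof. by rewrite unlock => P Q; rewrite rmorphB. Qed.

Let rotation_monoid : monoid_morphism (rotation a).
Proof. by rewrite unlock; split=> [|P Q]; rewrite ?rmorph1 ?rmorphM. Qed.

HB.instance Definition _ :=
  GRing.isZmodMorphism.Build {poly 'F_2} (group_algebra 'F_2 gT) (rotation a) rotation_zmod.
HB.instance Definition _ :=
  GRing.isMonoidMorphism.Build {poly 'F_2} (group_algebra 'F_2 gT) (rotation a) rotation_monoid.

Lemma rotationC c : rotation a c%:P = c%:A.
Proof. by rewrite unlock horner_algC. Qed.

Lemma rotationXn i : rotation a 'X^i = ga_delta _ (a ^+ i)%g.
Proof. by rewrite unlock rmorphXn /= horner_algX ga_deltaX. Qed.

Lemma rotationX : rotation a 'X = ga_delta _ a.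
Proof. by rewrite -['X]expr1 rotationXn expg1. Qed.

Lemma rotationZ c P : rotation a (c *: P) = c *: rotation a P.
Proof. by rewrite -mul_polyC rmorphM /= rotationC mulr_algl. Qed.

End Rotation.

Section DihedralAlgebra.

Variables (gT : finGroupType) (p d : nat) (a b : gT) (L : fieldExtType 'F_2).
Hypotheses (p_pr : prime p) (p_odd : odd p).
Hypotheses (oa : #[a]%g = p) (b_notin : b \notin <[a]>%g).
Hypothesis dih_elt : forall g, exists i, (g = a ^+ i \/ g = a ^+ i * b)%g.
Hypotheses (b2 : (b ^+ 2 = 1)%g) (ab : (a ^ b = a^-1)%g).
Hypothesis two_prim : d.-primitive_root (2%:R : 'F_p).
Hypothesis L_frob : forall x : L, x ^+ (2 ^ d) = x.
Variable zeta : L.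
Hypothesis zeta_prim : p.-primitive_root zeta.

Local Notation FD := (group_algebra 'F_2 gT).
Local Notation dl := (@ga_delta 'F_2 gT).
Local Notation ev := (@horner_alg 'F_2 L).
Local Notation rot := (rotation a).
Local Notation inv P := (inv_poly p P).
Implicit Types P Q : {poly 'F_2}.

(** Every element of the group algebra has this form, and [P] and [Q] matter only
    through their values at the [p]-th roots of unity. *)
Definition dih (P Q : {poly 'F_2}) : FD := rot P + rot Q * dl b.

Definition dih_norm P Q := P * inv P + Q * inv Q.

Let da_p : dl a ^+ p = 1.
Proof. by rewrite -ga_deltaX -oa expg_order ga_delta1. Qed.

Let bb : (b * b = 1)%g.
Proof. exact: b2. Qed.

Let b_inv : (b^-1 = b)%g.
Proof. by apply/eqP; rewrite eq_invg_mul bb. Qed.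

Let ba : (b * a = a^-1 * b)%g.
Proof. by rewrite -ab conjgE b_inv -!mulgA bb mulg1. Qed.

Let db2 : dl b * dl b = 1.
Proof. by rewrite -ga_deltaM bb ga_delta1. Qed.

Let a_pred : (a ^+ p.-1 = a^-1)%g.
Proof.
apply/eqP.
by rewrite eq_sym eq_invg_mul -expgS prednK ?prime_gt0 // -oa expg_order.
Qed.

Let rot_supp P h : h \notin <[a]>%g -> rot P h = 0.
Proof.
elim/poly_ind: P h => [|P c IHP] h ha; first by rewrite rmorph0 ffunE.
rewrite rmorphD rmorphM /= rotationX rotationC ffunE ga_mul_delta IHP ?add0r.
  by rewrite ffunE ffunE (negPf (group1_contra ha)) /=; apply: mulr0.
by rewrite groupMr // groupV cycle_id.
Qed.

Let rot_free P : (size P <= p)%N -> horner_alg (dl a) P = 0 -> P = 0.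
Proof.
move=> szP P0; apply/polyP=> j; rewrite coef0.
have [lt_jp|/(leq_trans szP)/(nth_default 0)//] := ltnP j p.
have coef_rot (i : nat) :
    ((map_poly (in_alg FD) P)`_i * dl a ^+ i) (a ^+ j)%g = P`_i * ((a ^+ j)%g == (a ^+ i)%g)%:R.
  by rewrite coef_map /= mulr_algl -ga_deltaX !ffunE.
have := congr1 (fun x : FD => x (a ^+ j)%g) P0; rewrite [RHS]ffunE.
rewrite [horner_alg _ P](horner_coef_wide (n := p)) ?(leq_trans (size_poly _ _)) //.
rewrite sum_ffunE (bigD1 (Ordinal lt_jp)) //= big1 => [|i neq_ij].
  by rewrite coef_rot eqxx mulr1 addr0.
rewrite coef_rot eq_expg_mod_order oa !modn_small //.
by rewrite eq_sym (inj_eq val_inj i (Ordinal lt_jp)) (negPf neq_ij) mulr0.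
Qed.

(** Equality in the commutative subalgebra generated by [a] can be tested on
    values; this replaces all computation modulo [X^p - 1]. *)
Lemma rotation_evP P Q : rot P = rot Q <-> forall y : L, y ^+ p = 1 -> ev y P = ev y Q.
Proof.
have := horner_alg_eq0P p_pr zeta_prim (P - Q) da_p rot_free; rewrite -rotationE rmorphB /= => PQ.
split=> [E y yp|E].
  apply/eqP; rewrite -subr_eq0 -(rmorphB (horner_alg y)); apply/eqP.
  by move: y yp; apply: PQ.1; rewrite E subrr.
apply/eqP; rewrite -subr_eq0; apply/eqP; apply: PQ.2 => y yp.
by rewrite rmorphB /= E // subrr.
Qed.

Lemma rot_inv_polyK P : rot (inv (inv P)) = rot P.
Proof.
apply/rotation_evP=> y yp.
by rewrite !ev_inv_poly ?invrK // exprVn yp invr1.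
Qed.

Lemma dihP (x : FD) : exists P Q, x = dih P Q.
Proof.
rewrite (ga_sum x); apply: (big_ind (fun x => exists P Q, x = dih P Q)).
- by exists 0, 0; rewrite /dih !rmorph0 mul0r addr0.
- move=> _ _ [P [Q ->]] [P' [Q' ->]].
  by exists (P + P'), (Q + Q'); rewrite /dih !rmorphD mulrDl addrACA.
move=> g _; have [i [->|->]] := dih_elt g.
  exists (x (a ^+ i)%g *: 'X^i), 0.
  by rewrite /dih rotationZ rotationXn rmorph0 mul0r addr0 ga_deltaX.
exists 0, (x (a ^+ i * b)%g *: 'X^i).
by rewrite /dih rotationZ rotationXn rmorph0 add0r ga_deltaM ga_deltaX scalerAl.
Qed.

Lemma dih_inj P Q P' Q' : dih P Q = dih P' Q' -> rot P = rot P' /\ rot Q = rot Q'.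
Proof.
move=> E; suff EP: rot P = rot P'.
  split=> //; move: E; rewrite /dih EP => /addrI/(congr1 ( *%R^~ (dl b))).
  by rewrite /= -!mulrA db2 !mulr1.
apply/ffunP=> h; have [ha|ha] := boolP (h \in <[a]>%g); last by rewrite !rot_supp.
have addE (x y : FD) : (x + y) h = x h + y h by rewrite ffunE.
have := congr1 (fun x : FD => x h) E; rewrite /dih !addE !ga_mul_delta.
have hb : (h * b^-1)%g \notin <[a]>%g by rewrite groupMl // groupV.
by rewrite ![rotation a _ (h * b^-1)%g]rot_supp // !addr0.
Qed.

Lemma rot_comm P Q : rot P * rot Q = rot Q * rot P.
Proof. by rewrite -!rmorphM /= mulrC. Qed.

Lemma reflectionM P : dl b * rot P = rot (inv P) * dl b.
Proof.
elim/poly_ind: P => [|P c IHP]; first by rewrite inv_poly0 !rmorph0 mulr0 mul0r.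
rewrite inv_poly_MXaddC !rmorphD !rmorphM /= !rotationC rotationX.
rewrite mulrDr mulrDl [in LHS]mulrA IHP -[in LHS]mulrA -[in RHS]mulrA.
by rewrite rotationXn a_pred -!ga_deltaM ba -scalerAr -scalerAl mulr1 mul1r.
Qed.

Lemma dihM P Q P' Q' :
  dih P Q * dih P' Q' = dih (P * P' + Q * inv Q') (P * Q' + Q * inv P').
Proof.
rewrite /dih !rmorphD !rmorphM /= mulrDr !mulrDl -!mulrA.
rewrite [dl b * rot P']reflectionM [dl b * (rot Q' * _)]mulrA reflectionM -!mulrA db2 mulr1.
by rewrite !mulrA addrACA [rot Q * _ * _ + _]addrC addrACA.
Qed.

Lemma star_rotation P : ga_star (rot P) = rot (inv P).
Proof.
elim/poly_ind: P => [|P c IHP].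
  by rewrite inv_poly0 !rmorph0; apply/ffunP=> g; rewrite ga_starE !ffunE.
rewrite inv_poly_MXaddC !rmorphD !rmorphM /= !rotationC rotationX.
by rewrite ga_starD ga_star_alg ga_starM IHP ga_star_delta -a_pred -rotationXn rot_comm.
Qed.

Lemma star_dih P Q : ga_star (dih P Q) = dih (inv P) Q.
Proof.
rewrite /dih ga_starD ga_starM !star_rotation ga_star_delta.
by rewrite b_inv reflectionM rot_inv_polyK.
Qed.

(** The two terms in [b] are equal, so they cancel in characteristic two. *)
Lemma dih_norm_star P Q : dih P Q * ga_star (dih P Q) = rot (dih_norm P Q).
Proof.
have cross0: rot (P * Q + Q * inv (inv P)) = 0.
  by rewrite rmorphD !rmorphM /= rot_inv_polyK rot_comm addrr_alg2.
by rewrite star_dih dihM /dih cross0 mul0r addr0.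
Qed.

Lemma unitary_dihP (u : {unit FD}) P Q : val u = dih P Q ->
  reflect (rot (dih_norm P Q) = 1) (u \in unitary 'F_2 gT).
Proof. by move=> def_u; apply: (iffP (unitary_mulVP u)); rewrite def_u dih_norm_star. Qed.

Let evD (y : L) P Q : ev y (P + Q) = ev y P + ev y Q. Proof. exact: rmorphD. Qed.
Let evM (y : L) P Q : ev y (P * Q) = ev y P * ev y Q. Proof. exact: rmorphM. Qed.
Let ev0 (y : L) : ev y 0 = 0. Proof. exact: rmorph0. Qed.
Let ev1 (y : L) : ev y 1 = 1. Proof. exact: rmorph1. Qed.
Let evX (y : L) n P : ev y (P ^+ n) = ev y P ^+ n. Proof. exact: rmorphXn. Qed.
Let ev_X (y : L) i : ev y 'X^i = y ^+ i.
Proof. by rewrite rmorphXn /= horner_algX. Qed.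
Let evE := (evD, evM, ev0, ev1, ev_X).

Let one_p : (1 : L) ^+ p = 1. Proof. exact: expr1n. Qed.

Let inv_unity (y : L) : y ^+ p = 1 -> y^-1 ^+ p = 1.
Proof. by move=> yp; rewrite exprVn yp invr1. Qed.

Let ev_inv (y : L) P : y ^+ p = 1 -> ev y (inv P) = ev y^-1 P.
Proof. exact: ev_inv_poly. Qed.

Lemma dih_ext P Q P' Q' : (forall y : L, y ^+ p = 1 -> ev y P = ev y P') ->
  (forall y : L, y ^+ p = 1 -> ev y Q = ev y Q') -> dih P Q = dih P' Q'.
Proof. by move=> /rotation_evP EP /rotation_evP EQ; rewrite /dih EP EQ. Qed.

Lemma dih_ev P Q P' Q' (y : L) : dih P Q = dih P' Q' -> y ^+ p = 1 ->
  ev y P = ev y P' /\ ev y Q = ev y Q'.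
Proof. by move=> /dih_inj[/rotation_evP EP /rotation_evP EQ] yp; rewrite EP ?EQ. Qed.

Lemma dih1 : dih 1 0 = 1.
Proof. by rewrite /dih rmorph1 rmorph0 mul0r addr0. Qed.

Lemma unitary_evP (u : {unit FD}) P Q : val u = dih P Q ->
  (u \in unitary 'F_2 gT) <->
  (forall y : L, y ^+ p = 1 -> ev y P * ev y^-1 P + ev y Q * ev y^-1 Q = 1).
Proof.
move=> def_u; have evN (y : L) : y ^+ p = 1 ->
    ev y (dih_norm P Q) = ev y P * ev y^-1 P + ev y Q * ev y^-1 Q.
  by move=> yp; rewrite !evE !ev_inv.
split=> [/(unitary_dihP def_u) N1 y yp|N1].
  by rewrite -evN // -(rmorph1 (horner_alg y)); apply/rotation_evP: y yp; rewrite rmorph1.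
apply/(unitary_dihP def_u); rewrite -(rmorph1 (rotation a)).
by apply/rotation_evP=> y yp; rewrite evN // N1 // rmorph1.
Qed.

(** * The subgroup generated by the bicyclic units *)

(** The unitary units that act as the identity on the component of the group
    algebra where [a] becomes 1; away from that component the norm is the
    determinant, hence the name. *)
Definition special_unitary : {set {unit FD}} :=
  [set u in unitary 'F_2 gT | val u * ga_hat _ a == ga_hat _ a].

Lemma special_group_set : group_set special_unitary.
Proof.
apply/group_setP; split=> [|u v /setIdP[Uu /eqP Su] /setIdP[Uv /eqP Sv]].
  by apply/setIdP; rewrite group1 mul1r.
by apply/setIdP; rewrite groupM // -mulrA Sv Su.
Qed.

Canonical special_group := Group special_group_set.

Lemma special_evP (u : {unit FD}) P Q : val u = dih P Q ->
  (u \in special_unitary) <-> [/\ u \in unitary 'F_2 gT, ev 1 P = 1 & ev 1 Q = 0].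
Proof.
move=> def_u.
(* The sum of the powers of a vanishes at every point except 1. *)
pose H : {poly 'F_2} := \sum_(i < p) 'X^i.
have evH (y : L) : y ^+ p = 1 -> ev y H = (y == 1)%:R.
  move=> yp; rewrite rmorph_sum /=; under eq_bigr do rewrite rmorphXn /= horner_algX.
  have [->|ny1] := eqVneq y 1.
    under eq_bigr do rewrite expr1n; rewrite sumr_const card_ord -(odd_double_half p) p_odd.
    by rewrite -mul2n mulrnDr mulrnA mulr2n addrr_alg2 mul0rn addr0.
  apply: (mulfI (_ : y - 1 != 0)); first by rewrite subr_eq0.
  by rewrite mulr0 -subrX1 yp subrr.
have hatE : ga_hat _ a = dih H 0.
  rewrite /dih rmorph0 mul0r addr0 /ga_hat oa rmorph_sum /=.
  by apply: eq_bigr => i _; rewrite rotationXn ga_deltaX.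
rewrite /special_unitary in_set def_u hatE dihM.
split=> [/andP[-> /eqP E]|[-> P1 Q0]].
  have [] := dih_ev E one_p; rewrite !evE !(ev_inv _ one_p) ?evE invr1 (evH _ one_p) eqxx.
  by rewrite !mulr0 !mulr1 addr0 add0r.
apply/eqP/dih_ext => y yp; rewrite !evE !(ev_inv _ yp) ?evE !evH ?inv_unity //.
  rewrite mulr0 addr0; case: eqVneq => [->|_]; first by rewrite P1 mulr1.
  by rewrite mulr0.
rewrite mulr0 add0r invr_eq1; case: eqVneq => [->|_]; first by rewrite Q0 mul0r.
by rewrite mulr0.
Qed.

(** Since [<[a ^+ i]>] is normal, [ga_hat (a ^+ i)] can be moved to the left past
    [h], where it annihilates [a ^+ i - 1]. *)
Lemma bicyclic_rotation i h : bicyclic 'F_2 (a ^+ i) h = 1.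
Proof.
set g := (a ^+ i)%g.
rewrite /bicyclic -[RHS]addr0; congr (1 + _).
have [G hatE] : exists G, ga_hat 'F_2 g = rot G.
  exists (\sum_(l < #[g]%g) 'X^i ^+ l); rewrite rmorph_sum; apply: eq_bigr => l _.
  by rewrite rmorphXn /= rotationXn.
have hat0 := ga_hat_subr1 'F_2 g; rewrite hatE -rotationXn in hat0 *.
have {}hat0 : forall y : L, y ^+ p = 1 -> ev y G * (y ^+ i + 1) = 0.
  rewrite subr_alg2 -(rmorph1 (rotation a)) -rmorphD -rmorphM -(rmorph0 (rotation a)) in hat0.
  by move=> y yp; have /rotation_evP/(_ y yp) := hat0; rewrite !evE.
rewrite subr_alg2 -(rmorph1 (rotation a)) -rmorphD.
have [j [->|->]] := dih_elt h; rewrite ?ga_deltaM -rotationXn.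
  rewrite -!rmorphM -(rmorph0 (rotation a)); apply/rotation_evP=> y yp.
  by rewrite !evE mulrAC [_ * ev y G]mulrC hat0 ?mul0r.
rewrite -!mulrA reflectionM !mulrA -!rmorphM /=.
suff -> : rot (('X^i + 1) * 'X^j * inv G) = rot 0 by rewrite rmorph0 mul0r.
apply/rotation_evP=> y yp; rewrite !evE ev_inv //.
have /eqP := hat0 _ (inv_unity yp); rewrite mulf_eq0 exprVn eqr_add_alg2 invr_eq1.
by case/orP=> /eqP->; rewrite ?mulr0 // addrr_alg2 !mul0r.
Qed.

Lemma reflection_order i : #[(a ^+ i * b)%g]%g = 2%N.
Proof.
apply: nt_prime_order => //; last first.
  apply: contra b_notin => /eqP/(canRL (mulKg _)) def_b.
  by rewrite def_b mulg1 groupV mem_cycle.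
rewrite expgS expg1 -!mulgA -{1}b_inv -conjgE.
by rewrite conjXg ab expVgn mulgV.
Qed.

Lemma dihD P Q P' Q' : dih P Q + dih P' Q' = dih (P + P') (Q + Q').
Proof. by rewrite /dih !rmorphD mulrDl addrACA. Qed.

Lemma dl_rotation i : dl (a ^+ i)%g = dih 'X^i 0.
Proof. by rewrite /dih rmorph0 mul0r addr0 rotationXn. Qed.

Lemma dl_reflection i : dl (a ^+ i * b)%g = dih 0 'X^i.
Proof. by rewrite /dih rmorph0 add0r ga_deltaM rotationXn. Qed.

Let hat_reflection i (s := (a ^+ i * b)%g) :
  ga_hat 'F_2 s = 1 + dl s /\ dl s * (1 + dl s) = 1 + dl s.
Proof.
split; first by rewrite /ga_hat reflection_order big_ord_recr big_ord1 expr0 expr1.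
rewrite mulrDr mulr1 -ga_deltaM -(expgS s 1) -(reflection_order i) expg_order.
by rewrite ga_delta1 addrC.
Qed.

Lemma bicyclic_reflection i j : bicyclic 'F_2 (a ^+ i * b) (a ^+ j) =
  dih (1 + ('X^j + inv 'X^j)) (('X^j + inv 'X^j) * 'X^i).
Proof.
rewrite /bicyclic -mulrA (hat_reflection i).1 subr_alg2 dl_reflection dl_rotation -dih1.
rewrite !dihD !(dihM, dihD); apply: dih_ext => y yp.
all: rewrite !evE !(ev_inv _ yp) ?evE !(ev_inv _ (inv_unity yp)) !evE !exprVn.
all: have := expf_neq0 i (unity_root_neq0 p_pr yp).
  by move=> nzy; rewrite !(add0r, addr0, mul0r, mulr0, mulr1, mul1r) mulrCA divff // mulr1.
by move=> nzy; rewrite !(add0r, addr0, mul0r, mulr0, mulr1, mul1r) mulrDl [_ * (y ^+ j)^-1]mulrC.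
Qed.

(** For [s] a reflection, [h] can be replaced by [h * s], and one of the two is a
    rotation. *)
Lemma bicyclic_reflection_rotation i h :
  exists j, bicyclic 'F_2 (a ^+ i * b) h = bicyclic 'F_2 (a ^+ i * b) (a ^+ j).
Proof.
have [j [->|def_h]] := dih_elt h; first by exists j.
set s := (a ^+ i * b)%g; have [hatE hat_s] := hat_reflection i.
have /cycleP[j' def_j'] : (h * s^-1)%g \in <[a]>%g.
  by rewrite def_h /s invMg mulgA mulgK groupM ?groupV ?mem_cycle.
exists j'; rewrite /bicyclic; congr (1 + _); rewrite -mulrA -[RHS]mulrA; congr (_ * _).
by rewrite -def_j' hatE -[in RHS]hat_s [RHS]mulrA -ga_deltaM mulgKV.
Qed.

Local Notation BC := (bicyclic_group 'F_2 gT).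

Lemma bicyclic_special : BC \subset special_unitary.
Proof.
rewrite gen_subG; apply/subsetP=> _ /imset2P[g h _ _ ->].
have [i [->|->]] := dih_elt g.
  rewrite (_ : bicyclic_unit _ _ _ = 1%g) ?group1 //.
  by apply: val_inj; rewrite /= bicyclic_rotation.
have [j def_j] := bicyclic_reflection_rotation i h.
have def_u : val (bicyclic_unit 'F_2 (a ^+ i * b)%g h) =
    dih (1 + ('X^j + inv 'X^j)) (('X^j + inv 'X^j) * 'X^i).
  exact: (etrans def_j (bicyclic_reflection i j)).
apply/(special_evP def_u); split.
- apply/(unitary_evP def_u) => y yp; rewrite !evE !(ev_inv _ yp) ?evE.
  rewrite !(ev_inv _ (inv_unity yp)) ?evE invrK.
  have := expf_neq0 i (unity_root_neq0 p_pr yp); rewrite !exprVn.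
  set t := y ^+ j + _; set t' := _^-1 + _ => nzy.
  have -> : t' = t by apply: addrC.
  rewrite mulrACA divff // mulr1 -!expr2 sqrrD_alg2 expr1n.
  by rewrite -addrA addrr_alg2 addr0.
- by rewrite !evE ev_inv ?expr1n // invr1 !evE !expr1n addrr_alg2 addr0.
by rewrite !evE ev_inv ?expr1n // invr1 !evE !expr1n addrr_alg2 mul0r.
Qed.

Let d_gt1 : (1 < d)%N.
Proof.
rewrite ltn_neqAle eq_sym (prim_order_gt0 two_prim) andbT; apply/eqP=> d1.
have := prim_expr_order two_prim; rewrite d1 expr1 => /eqP.
by rewrite -subr_eq0 -[2%:R]/(1 + 1) addrK oner_eq0.
Qed.

(** The power [2 ^ d - 2] inverts the nonzero elements of [L], and it sends 0 to 0,
    in agreement with the convention for [^-1]. *)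
Let ev_pinv (y : L) P : ev y (P ^+ (2 ^ d - 2)) = (ev y P)^-1.
Proof.
have d2 : (2 < 2 ^ d)%N by rewrite (@ltn_exp2l 2 1).
have eq2 : (2 ^ d - 2).+2 = (2 ^ d)%N by rewrite -addn2 subnK // ltnW.
rewrite rmorphXn /=; have [->|nz] := eqVneq (ev y P) 0.
  by rewrite expr0n invr0 subn_eq0 leqNgt d2.
apply: (mulIf nz); apply: (mulIf nz); rewrite mulVf // mul1r -!exprSr.
by rewrite eq2 L_frob.
Qed.

Lemma unity_sqr_eq1 (y : L) : y ^+ p = 1 -> y ^+ 2 = 1 -> y = 1.
Proof.
move=> yp y2; rewrite -yp -[in RHS](odd_double_half p) p_odd exprS -mul2n exprM y2.
by rewrite expr1n mulr1.
Qed.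

Lemma kappa_neq0 (y : L) : y ^+ p = 1 -> y != 1 -> y + y^-1 != 0.
Proof.
move=> yp; apply: contra; rewrite eqr_add_alg2 => /eqP y_inv.
have nzy := unity_root_neq0 p_pr yp.
by apply/eqP/unity_sqr_eq1; rewrite // expr2 -[X in _ * X]invrK -y_inv mulfV.
Qed.

Local Notation sym := (@sym_poly p L).

(** The map [c] to [1 + c (1 + a^i b)] turns sums into products on symmetric [c],
    because [1 + a^i b] has square zero; on monomials [r] the element below is a
    bicyclic unit. *)
Lemma transvection_trace i (r : {poly 'F_2}) : exists2 u, u \in BC &
  val u = dih (1 + (r + inv r)) ((r + inv r) * 'X^i).
Proof.
rewrite -[r]coefK poly_def; elim/big_ind: _ => [|P Q [u Bu def_u] [v Bv def_v]|j _].
- by exists 1%g; rewrite ?group1 // inv_poly0 addr0 mul0r addr0 dih1.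
- exists (u * v)%g; first exact: groupM.
  rewrite [LHS]/= def_u def_v dihM inv_polyD; apply: dih_ext => y yp.
  all: rewrite ?evE ?(ev_inv _ yp) ?evE ?(ev_inv _ (inv_unity yp)) ?invrK ?evE.
    rewrite exprVn; set c := ev y P + _; set c' := ev y Q + _.
    char2 (c * c'); rewrite /c /c'; field.
    exact: expf_neq0 (unity_root_neq0 p_pr yp).
  by char2 ((ev y P + ev y^-1 P) * (ev y Q + ev y^-1 Q) * y ^+ i); ring.
case/orP: (F2_cases r`_j) => /eqP->.
  exists 1%g; rewrite ?group1 // scale0r inv_poly0 addr0 mul0r addr0 dih1 //.
exists (bicyclic_unit 'F_2 (a ^+ i * b)%g (a ^+ j)%g).
  by apply: mem_gen; apply: imset2_f.
by rewrite scale1r; apply: bicyclic_reflection.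
Qed.

(** The value [(1, a)] of the alternating form. *)
Definition kappa : {poly 'F_2} := 'X^1 + inv 'X^1.

Lemma ev_kappa (y : L) : y ^+ p = 1 -> ev y kappa = y + y^-1.
Proof. by move=> yp; rewrite !evE ev_inv // evE !expr1. Qed.

Lemma ev_kappa_eq0 (y : L) : y ^+ p = 1 -> ev y kappa = 0 -> y = 1.
Proof.
move=> yp; rewrite ev_kappa // => K0; apply/eqP; apply: contraTT isT => ny1.
by have := kappa_neq0 yp ny1; rewrite K0 eqxx.
Qed.

Lemma ev1_kappa : ev 1 kappa = 0.
Proof. by rewrite ev_kappa // invr1 addrr_alg2. Qed.

Lemma sym_kappa : sym kappa.
Proof. by move=> y yp; rewrite !ev_kappa ?inv_unity // invrK addrC. Qed.

(** A symmetric [c] that vanishes at 1 is a trace [r + r'], for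
    [r = c a / (a + a^-1)]. *)
Lemma transvection_mem i (c : {poly 'F_2}) : sym c -> ev 1 c = 0 ->
  exists2 u, u \in BC & val u = dih (1 + c) (c * 'X^i).
Proof.
move=> sc c1; pose r := c * 'X^1 * kappa ^+ (2 ^ d - 2).
have [u Bu def_u] := transvection_trace i r; exists u => //; rewrite {}def_u.
have rc (y : L) : y ^+ p = 1 -> ev y (r + inv r) = ev y c.
  move=> yp; rewrite evD ev_inv // /r !(evM, ev_X) !ev_pinv !expr1.
  rewrite (sym_kappa yp) (sc _ yp) -mulrDl -mulrDr.
  have [/(ev_kappa_eq0 yp)->|nzK] := eqVneq (ev y kappa) 0; first by rewrite c1 !mul0r.
  by rewrite -ev_kappa // mulfK.
by apply: dih_ext => y yp; [rewrite evD rc // evD | rewrite evM rc // evM].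
Qed.

(** [T0] and [T1] are the values of the alternating form on [(w, 1)] and
    [(w, a)], where [w = P + Q] describes the image of [1 + b] under the unit
    [u]. *)
Definition pairings (u : {unit FD}) (T0 T1 : {poly 'F_2}) := exists P Q,
  [/\ val u = dih P Q, ev 1 (P + Q) = 1 & forall y : L, y ^+ p = 1 ->
    ev y T0 = ev y (P + Q) + ev y^-1 (P + Q) /\
    ev y T1 = y^-1 * ev y (P + Q) + y * ev y^-1 (P + Q)].

Lemma pairings_sym u T0 T1 : pairings u T0 T1 ->
  [/\ sym T0, sym T1, ev 1 T0 = 0 & ev 1 T1 = 0].
Proof.
case=> P [Q [_ _ TE]]; split=> [y yp|y yp||].
- by rewrite (TE _ yp).1 (TE _ (inv_unity yp)).1 invrK addrC.
- by rewrite (TE _ yp).2 (TE _ (inv_unity yp)).2 invrK addrC.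
- by rewrite (TE _ one_p).1 invr1 addrr_alg2.
by rewrite (TE _ one_p).2 invr1 addrr_alg2.
Qed.

(** One step of the column reduction.  The transvection along 1 (for [j = false])
    or along [a] (for [j = true]) keeps the pairing with its own direction and
    adds to the other one a multiple of it; any [t] that vanishes where the kept
    pairing does is such a multiple. *)
Lemma transvection_step (j : bool) u T0 T1 (t : {poly 'F_2}) :
    pairings u T0 T1 -> sym t -> ev 1 t = 0 ->
    (forall y : L, y ^+ p = 1 -> ev y (if j then T1 else T0) = 0 -> ev y t = 0) ->
  exists2 g, g \in BC &
    pairings (g * u)%g (if j then T0 + t else T0) (if j then T1 else T1 + t).
Proof.
move=> pair_u st t1; set T := (if j then T1 else T0) => Tt.
have [sT0 sT1 T01 T11] := pairings_sym pair_u; case: pair_u => P [Q [def_u w1 TE]].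
have sT : sym T by rewrite /T; case: (j).
pose c := t * (kappa * T) ^+ (2 ^ d - 2).
have evc (y : L) : ev y c = ev y t / (ev y kappa * ev y T) by rewrite evM ev_pinv evM.
have sc : sym c by move=> y yp; rewrite !evc (st _ yp) (sT _ yp) sym_kappa.
have c1 : ev 1 c = 0 by rewrite evc t1 mul0r.
have [g Bg def_g] := transvection_mem j.*2 sc c1; exists g => //.
set P' := (1 + c) * P + c * 'X^(j.*2) * inv Q.
set Q' := (1 + c) * Q + c * 'X^(j.*2) * inv P.
have def_gu : val (g * u)%g = dih P' Q' by rewrite [LHS]/= def_g def_u dihM.
have wE (y : L) : y ^+ p = 1 -> ev y (P' + Q') =
    ev y (P + Q) + ev y c * (ev y (P + Q) + y ^+ j.*2 * ev y^-1 (P + Q)).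
  by move=> yp; rewrite !evE !(ev_inv _ yp); ring.
exists P', Q'; split=> [||y yp]; first exact: def_gu.
  by rewrite wE // c1 mul0r addr0.
have y'p := inv_unity yp; have nzy := unity_root_neq0 p_pr yp.
have ct : ev y c * ev y kappa * ev y T = ev y t.
  rewrite evc; have [/(Tt _ yp)->|nzT] := eqVneq (ev y T) 0; first by rewrite !mul0r.
  have [/(ev_kappa_eq0 yp)->|nzK] := eqVneq (ev y kappa) 0; first by rewrite t1 !mul0r.
  by rewrite -mulrA mulfVK // mulf_neq0.
rewrite !wE // (sc _ yp) invrK; move: ct; rewrite ev_kappa // /T.
case: (j) => /= ct; rewrite [ev y (_ + t)]evD -ct (TE _ yp).1 (TE _ yp).2.
all: set w := ev y (P + Q); set w' := ev y^-1 (P + Q); set e := ev y c.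
  split; first by field.
  by apply/esym; char2 (e * (y^-1 * w + y * w')); field.
split; last by field.
by apply/esym; char2 (e * (w + w')); ring.
Qed.

(** If both pairings vanish then [w] vanishes, as 1 and [a] form a basis; then
    [P] and [Q] have equal values and the norm vanishes. *)
Lemma pairings_neq0 u T0 T1 (y : L) : u \in unitary 'F_2 gT -> pairings u T0 T1 ->
  y ^+ p = 1 -> y != 1 -> ev y T1 = 0 -> ev y T0 <> 0.
Proof.
move=> Uu [P [Q [def_u _ TE]]] yp ny1.
have := (unitary_evP def_u).1 Uu y yp; rewrite (TE _ yp).1 (TE _ yp).2 !evD.
set x := ev y P; set x' := ev y^-1 P; set z := ev y Q; set z' := ev y^-1 Q.
move=> N1 T10 /eqP; rewrite eqr_add_alg2 => /eqP T00; move: T10.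
rewrite -T00 -mulrDl addrC => /eqP; rewrite mulf_eq0 (negPf (kappa_neq0 yp ny1)) /=.
rewrite eqr_add_alg2 => /eqP xz; move: T00; rewrite xz addrr_alg2 => /esym/eqP.
rewrite eqr_add_alg2 => /eqP xz'; move: N1; rewrite xz xz' addrr_alg2 => /eqP.
by rewrite eq_sym oner_eq0.
Qed.

(** The pairings are those of [w = 1].  Then [P = 1 + Q], and norm 1 forces [Q] to
    be symmetric. *)
Lemma pairings_one_bicyclic v T0 T1 : v \in special_unitary -> pairings v T0 T1 ->
  (forall y : L, ev y T0 = 0) -> (forall y : L, ev y T1 = ev y kappa) -> v \in BC.
Proof.
move=> Sv [P [Q [def_v w1 TE]]] T00 T1k.
have PQ1 (y : L) : y ^+ p = 1 -> ev y P = 1 + ev y Q.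
  move=> yp; suff: ev y (P + Q) = 1.
    by rewrite evD => <-; rewrite -addrA addrr_alg2 addr0.
  have [->|ny1] := eqVneq y 1; first by [].
  have [] := TE y yp; rewrite T00 T1k => /esym/eqP; rewrite eqr_add_alg2.
  move/eqP <-; rewrite -mulrDl [_ + y]addrC -ev_kappa //.
  have nzK : ev y kappa != 0 by rewrite ev_kappa ?kappa_neq0.
  by move/(congr1 (fun z => (ev y kappa)^-1 * z)); rewrite mulVf // mulKf.
have [Uv _ Q0] := (special_evP def_v).1 Sv.
have sQ : sym Q.
  move=> y yp; have := (unitary_evP def_v).1 Uv y yp; rewrite !PQ1 ?inv_unity //.
  set z := ev y Q; set z' := ev y^-1 Q => N1; apply/esym/eqP.
  rewrite -eqr_add_alg2 -(inj_eq (addrI 1)) addr0 -[X in _ == X]N1; apply/eqP.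
  by apply/esym; char2 (z * z'); ring.
have [g Bg def_g] := transvection_mem 0 sQ Q0.
suff <- : g = v by [].
apply: val_inj; rewrite def_v def_g; apply: dih_ext => y yp.
  by rewrite PQ1 // !evE.
by rewrite expr0 mulr1.
Qed.

(** Column reduction.  The first step makes the second pairing nonzero at every
    point other than 1, by adding the first pairing where it is zero; the next
    two steps make the first pairing, then the second one, equal to [kappa]; the
    last one cancels the first pairing. *)
Lemma special_bicyclic : special_unitary \subset BC.
Proof.
apply/subsetP=> u Su; have [P [Q def_u]] := dihP (val u).
have [Uu P1 Q0] := (special_evP def_u).1 Su.
have [T [R pair0]] : exists T R, pairings u T R.
  exists ((P + Q) + inv (P + Q)), (inv 'X^1 * (P + Q) + 'X^1 * inv (P + Q)), P, Q.
  split=> // [|y yp]; first by rewrite evD P1 Q0 addr0.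
  by rewrite !(evD, evM) !(ev_inv _ yp) !evE !expr1.
have [sT sR T1 R1] := pairings_sym pair0.
have sD A B : sym A -> sym B -> sym (A + B).
  by move=> sA sB y yp; rewrite !evD sA ?sB.
pose t := T * (1 + R * R ^+ (2 ^ d - 2)).
have evt (y : L) : ev y t = ev y T * (1 + ev y R / ev y R).
  by rewrite evM evD ev1 evM ev_pinv.
clearbody t.
have [||y yp /= T0|g1 Bg1 pair1] := transvection_step (j := false) (t := t) pair0.
- by move=> y yp; rewrite !evt sT ?sR.
- by rewrite evt T1 mul0r.
- by rewrite evt T0 mul0r.
have Rt_eq0 (y : L) : y ^+ p = 1 -> ev y (R + t) = 0 -> y = 1.
  move=> yp; rewrite evD evt => E; apply/eqP; apply: contraTT isT => ny1.
  have := pairings_neq0 Uu pair0 yp ny1; move: E; have [->|nzR] := eqVneq (ev y R) 0.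
    by rewrite mul0r addr0 mulr1 add0r => -> /(_ erefl).
  by rewrite divff // addrr_alg2 mulr0 addr0 => R0; rewrite R0 eqxx in nzR.
have [_ sRt _ Rt1] := pairings_sym pair1.
have [||y yp /(Rt_eq0 _ yp) ->|g2 Bg2 pair2] :=
  transvection_step (j := true) (t := T + kappa) pair1.
- by apply: sD sym_kappa.
- by rewrite evD T1 ev1_kappa addr0.
- by rewrite evD T1 ev1_kappa addr0.
have evT2 (y : L) : ev y (T + (T + kappa)) = ev y kappa.
  by rewrite !evD addrA addrr_alg2 add0r.
have [||y yp|g3 Bg3 pair3] :=
  transvection_step (j := false) (t := R + t + kappa) pair2.
- by apply: sD sym_kappa.
- by rewrite evD Rt1 ev1_kappa addr0.
- by rewrite evT2 => /(ev_kappa_eq0 yp)->; rewrite evD Rt1 ev1_kappa addr0.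
have evR3 (y : L) : ev y (R + t + (R + t + kappa)) = ev y kappa.
  by rewrite [LHS]evD [ev y (_ + kappa)]evD addrA addrr_alg2 add0r.
have [|||g4 Bg4 pair4] := transvection_step (j := true) (t := kappa) pair3.
- exact: sym_kappa.
- exact: ev1_kappa.
- by move=> y yp; rewrite evR3.
set v := (g4 * _)%g in pair4; suff Bv : v \in BC by move: Bv; rewrite /v !groupMl.
apply: pairings_one_bicyclic pair4 _ evR3 => [|y].
  by rewrite /v !groupM // (subsetP bicyclic_special).
by rewrite evD evT2 addrr_alg2.
Qed.

Let val_b : val (ga_unit 'F_2 b) = dih 0 1.
Proof. by rewrite /dih rmorph0 rmorph1 mul1r add0r. Qed.

Let unit_bb : (ga_unit 'F_2 b * ga_unit 'F_2 b = 1)%g.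
Proof. by apply: val_inj; rewrite /= db2. Qed.

Lemma unitary_reflection : ga_unit 'F_2 b \in unitary 'F_2 gT.
Proof. by apply/unitary_mulP; rewrite /= ga_star_delta b_inv db2. Qed.

Let ev1_inv P : ev 1 (inv P) = ev 1 P.
Proof. exact: ev1_inv_poly. Qed.

Lemma bicyclic_groupE : BC :=: special_unitary.
Proof. by apply/eqP; rewrite eqEsubset bicyclic_special special_bicyclic. Qed.

(** The norm at the point 1 is [(P + Q)^2], so exactly one of [u] and [u * b] acts
    trivially there. *)
Lemma unitary_sdprod : (BC ><| <[ga_unit 'F_2 b]> = unitary 'F_2 gT)%g.
Proof.
have Ub := unitary_reflection; rewrite bicyclic_groupE.
have unit_bV : ((ga_unit 'F_2 b)^-1 = ga_unit 'F_2 b)%g.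
  by apply/eqP; rewrite eq_invg_mul unit_bb.
rewrite sdprodE.
- apply/eqP; rewrite eqEsubset mul_subG ?cycle_subG //=; last first.
    by apply/subsetP=> u /setIdP[].
  apply/subsetP=> u Uu; have [P [Q def_u]] := dihP (val u).
  have N1 := (unitary_evP def_u).1 Uu 1 one_p; rewrite invr1 -!expr2 -sqrrD_alg2 in N1.
  have /eqP PQ1 := sqr_eq1_alg2 N1.
  have [/eqP P0|/eqP P1] := orP (ev1_F2 L P).
    rewrite P0 add0r in PQ1; rewrite -[u](mulgK (ga_unit 'F_2 b)).
    have def_ub : val (u * ga_unit 'F_2 b)%g = dih P Q * dih 0 1.
      by rewrite [LHS]/= -val_b def_u.
    rewrite dihM in def_ub; rewrite mem_mulg ?groupV ?cycle_id //.
    apply/(special_evP def_ub); split; first exact: groupM.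
      by rewrite !evE (ev_inv _ one_p) ev1 (eqP PQ1) mulr0 add0r mulr1.
    by rewrite !evE (ev_inv _ one_p) ev0 P0 mul0r mulr0 addr0.
  rewrite -[u]mulg1 mem_mulg //; apply/(special_evP def_u); split=> //.
  by move: PQ1; rewrite P1 -subr_eq0 addrC addKr => /eqP.
- rewrite cycle_subG inE; apply/subsetP=> _ /imsetP[u Su ->].
  have [P [Q def_u]] := dihP (val u).
  have [Uu P1 Q0] := (special_evP def_u).1 Su.
  have def_ub : val (u ^ ga_unit 'F_2 b)%g = dih 0 1 * (dih P Q * dih 0 1).
    by rewrite conjgE unit_bV [LHS]/= -val_b def_u.
  rewrite !dihM in def_ub; apply/(special_evP def_ub); split; first exact: groupJ.
    by rewrite !(evE, ev1_inv) P1 Q0; ring.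
  by rewrite !(evE, ev1_inv) P1 Q0; ring.
apply/trivgP/subsetP=> u /setIP[Su /cycleP[n def_n]]; apply/set1gP.
move: Su; rewrite {}def_n -(odd_double_half n) -mul2n expgD expgM.
rewrite [(_ ^+ 2)%g](_ : _ = 1%g) ?expg1n ?mulg1; last exact: unit_bb.
case: (odd n) => //; rewrite expg1 => /(special_evP val_b)[_ /eqP].
by rewrite ev0 eq_sym oner_eq0.
Qed.

(** * The central units *)

Local Notation k := (num_orbits p d).
Local Notation f := (sym_degree d).

Lemma sym_central P (x : FD) : sym P -> GRing.comm (rot P) x.
Proof.
move=> sP; have [Q [R ->]] := dihP x; rewrite /GRing.comm /dih mulrDr mulrDl.
rewrite rot_comm; congr (_ + _); rewrite mulrA rot_comm -!mulrA reflectionM.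
by congr (_ * (_ * _)); apply/rotation_evP => v vp; rewrite ev_inv // sP.
Qed.

Lemma ev_norm P Q (y : L) : y ^+ p = 1 ->
  ev y (dih_norm P Q) = ev y P * ev y^-1 P + ev y Q * ev y^-1 Q.
Proof. by move=> yp; rewrite !evE !ev_inv. Qed.

(** With [v] the inverse of [u], the product [u u^* v^* v] is 1. *)
Lemma norm_neq0 (u : {unit FD}) P Q (y : L) : val u = dih P Q ->
  y ^+ p = 1 -> ev y (dih_norm P Q) != 0.
Proof.
move=> def_u yp; set N := dih_norm P Q.
have [P' [Q' def_w]] := dihP (ga_star (val u^-1%g) * val u^-1%g).
have : dih N 0 * dih P' Q' = dih 1 0.
  rewrite {1}/dih rmorph0 mul0r addr0 -dih_norm_star -def_w -def_u dih1.
  rewrite -mulrA [ga_star _ * (_ * _)]mulrA -ga_starM -FinRing.val_unitM mulVg.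
  by rewrite ga_star1 mul1r -FinRing.val_unitM mulgV.
rewrite dihM => /dih_ev/(_ yp)[]; rewrite !evE mul0r addr0 => NP1 _.
by apply/eqP=> N0; move/eqP: NP1; rewrite N0 mul0r eq_sym oner_eq0.
Qed.

Lemma unitary_quotient (u g : {unit FD}) P Q c : val u = dih P Q -> val g = rot c ->
  sym c -> (forall y : L, y ^+ p = 1 -> ev y c ^+ 2 = ev y (dih_norm P Q)) ->
  (u * g^-1)%g \in unitary 'F_2 gT.
Proof.
move=> def_u def_g sc c2; have [P1 [Q1 def_h]] := dihP (val (u * g^-1)%g).
have : dih P1 Q1 * dih c 0 = dih P Q.
  have -> : dih c 0 = val g by rewrite /dih rmorph0 mul0r addr0 def_g.
  by rewrite -def_h -def_u -FinRing.val_unitM mulgKV.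
rewrite dihM => E; apply/(unitary_evP def_h) => y yp.
have Ey x : x ^+ p = 1 -> ev x P = ev x P1 * ev x c /\ ev x Q = ev x Q1 * ev x c.
  move=> xp; have [<- <-] := dih_ev E xp; rewrite !evE !ev_inv // ev0 sc //.
  by rewrite !mulr0 addr0 add0r.
have nzc : ev y c ^+ 2 != 0 by rewrite c2 // (norm_neq0 def_u).
have := ev_norm P Q yp; have [-> ->] := Ey _ yp; have [-> ->] := Ey _ (inv_unity yp).
rewrite -c2 // sc // => NE.
by apply: (mulIf nzc); rewrite mul1r [RHS]NE; ring.
Qed.

Lemma sym_unitary_eq1 (u : {unit FD}) P :
  val u = rot P -> sym P -> u \in unitary 'F_2 gT -> u = 1%g.
Proof.
move=> def_u sP Uu; have {}def_u : val u = dih P 0 by rewrite /dih rmorph0 mul0r addr0.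
apply: val_inj; rewrite def_u -[RHS]dih1; apply: dih_ext => // y yp.
have := (unitary_evP def_u).1 Uu y yp; rewrite sP // !ev0 mul0r addr0 -expr2 => P2.
by rewrite ev1; apply: sqr_eq1_alg2.
Qed.

Variable omega : L.
Hypothesis omega_prim : (2 ^ d - 1).-primitive_root omega.

(** At each representative the square root [c] of the norm of a unit takes as
    value a power of the generator [gamma]; the exponents give the decomposition
    of [c] as a product of powers of the [z i]. *)
Lemma central_units : exists z : 'I_k -> {unit FD},
  [/\ forall i (x : FD), GRing.comm (val (z i)) x,
      forall i, #[z i]%g = (2 ^ f - 1)%N
    & (unitary 'F_2 gT \x \big[dprod/1]_(i < k) <[z i]> = [set: {unit FD}])%g].
Proof.
set m := (2 ^ f - 1)%N.
have m_dvd : (m %| 2 ^ d - 1)%N.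
  rewrite /m /sym_degree; case: ifP => od //.
  rewrite -[in X in (_ %| X)%N](divnK (_ : 2 %| d)%N) ?dvdn2 ?od //.
  by rewrite expnM !subn1 dvdn_pred_predX.
have [gamma gamma_prim] : exists gamma : L, m.-primitive_root gamma.
  by exists (omega ^+ ((2 ^ d - 1) %/ m)%N); apply: dvdn_prim_root.
have m1 : m.+1 = (2 ^ f)%N by rewrite /m subn1 prednK ?expn_gt0.
have gamma_m := prim_expr_order gamma_prim.
have [y y_sep] := sym_representatives p_pr p_odd two_prim zeta_prim.
have [yp y_eq] := y_sep.
have rot_sep P Q : sym P -> sym Q -> ev 1 P = ev 1 Q ->
    (forall i, ev (y i) P = ev (y i) Q) -> rot P = rot Q.
  by move=> sP sQ PQ1 PQ; apply/rotation_evP; apply: y_eq.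
have [Z ZP] : exists Z : 'I_k -> {poly 'F_2}, forall i, [/\ sym (Z i), ev 1 (Z i) = 1 &
    forall j, ev (y j) (Z i) = if j == i then gamma else 1].
  apply: (@fin_all_exists _ _ (fun i P => [/\ sym P, ev 1 P = 1 &
    forall j, ev (y j) P = if j == i then gamma else 1])) => i.
  apply: (sym_interpolation p_pr p_odd two_prim L_frob zeta_prim gamma_prim y_sep) => j.
  by rewrite -m1; case: ifP => _; rewrite ?expr1n // exprSr gamma_m mul1r.
have sym1 : sym 1 by move=> x _; rewrite !ev1.
have symM P Q : sym P -> sym Q -> sym (P * Q).
  by move=> sP sQ x xp; rewrite !evM sP ?sQ.
have symX P n : sym P -> sym (P ^+ n).
  by move=> sP x xp; rewrite !evX sP.
have Zm i : rot (Z i ^+ m) = 1.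
  have [sZ Z1 Zy] := ZP i; rewrite -(rmorph1 (rotation a)).
  apply: rot_sep => // [||j]; first exact: symX.
    by rewrite evX Z1 expr1n ev1.
  by rewrite evX Zy ev1; case: ifP; rewrite ?expr1n ?gamma_m.
have m_gt0 := prim_order_gt0 gamma_prim.
have Zunit i : rot (Z i) \is a GRing.unit.
  apply/unitrP; exists (rot (Z i ^+ m.-1)).
  by rewrite -!rmorphM /= -exprS -exprSr prednK // Zm.
pose z i : {unit FD} := FinRing.unit FD (Zunit i).
have val_z (r : seq 'I_k) (e : 'I_k -> nat) :
    val (\prod_(i <- r) z i ^+ e i)%g = rot (\prod_(i <- r) Z i ^+ e i).
  rewrite rmorph_prod; elim: r => [|i r IHr]; rewrite ?big_nil // !big_cons /=.
  by rewrite IHr FinRing.val_unitX rmorphXn.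
have val_zX i n : val (z i ^+ n)%g = rot (Z i ^+ n).
  by rewrite FinRing.val_unitX rmorphXn.
have sym_prod (r : seq 'I_k) (e : 'I_k -> nat) : sym (\prod_(i <- r) Z i ^+ e i).
  by elim/big_rec: _ => // i P _ sP; apply: symM => //; apply: symX; case: (ZP i).
have ev_prod (x : L) (r : seq 'I_k) (e : 'I_k -> nat) :
    ev x (\prod_(i <- r) Z i ^+ e i) = \prod_(i <- r) ev x (Z i) ^+ e i.
  by rewrite rmorph_prod; apply: eq_bigr => i _; rewrite /= evX.
have order_z i : #[z i]%g = m.
  apply/eqP; rewrite eqn_dvd order_dvdn; apply/andP; split.
    by apply/eqP/val_inj; rewrite val_zX Zm.
  rewrite (prim_order_dvd gamma_prim); have := congr1 val (expg_order (z i)).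
  rewrite val_zX /= -(rmorph1 (rotation a)) => /rotation_evP/(_ (y i) (yp i)).
  by rewrite evX ev1; have [_ _ ->] := ZP i; rewrite eqxx => ->.
have [G defG] : exists G : {group {unit FD}}, (\big[dprod/1]_i <[z i]> = G)%g.
  apply: dprod_cycles_free => [i j|i n r e ri E].
    by apply: val_inj; apply: sym_central; case: (ZP i).
  have := congr1 val E; rewrite val_z val_zX => /rotation_evP/(_ (y i) (yp i)).
  rewrite evX ev_prod; have [_ _ ->] := ZP i; rewrite eqxx big_seq big1 => [gamma_n|j rj].
    by apply/eqP; rewrite -order_dvdn order_z (prim_order_dvd gamma_prim) gamma_n.
  have [_ _ ->] := ZP j; case: eqP => [eq_ij|_]; last by rewrite expr1n.
  by rewrite eq_ij rj in ri.
have memG u : u \in G -> exists2 P, sym P & val u = rot P.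
  rewrite -(bigdprodW defG) => /(mem_prod_cycles (index_enum_uniq _))[e ->].
  by exists (\prod_i Z i ^+ e i) => //; apply: val_z.
exists z; split=> [i x||] //.
  by apply: sym_central; case: (ZP i).
rewrite defG dprodE.
- apply/setP=> u; rewrite inE.
  have [P [Q def_u]] := dihP (val u); pose N := dih_norm P Q.
  have symN : sym N.
    move=> x xp; rewrite !ev_norm ?inv_unity // invrK.
    by congr (_ + _); rewrite mulrC.
  (* A square root of the norm, since x^(2^d) = x on values. *)
  pose c := N ^+ (2 ^ d.-1).
  have symc : sym c by apply: symX.
  have c2 (x : L) : ev x c ^+ 2 = ev x N.
    by rewrite evX -exprM -expnSr prednK ?L_frob // ltnW ?d_gt1.
  have nzc (x : L) : x ^+ p = 1 -> ev x c != 0 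
    by move=> xp; rewrite evX expf_neq0 // (norm_neq0 def_u).
  have [e def_e] : exists e : 'I_k -> nat, forall i, ev (y i) c = gamma ^+ e i.
    apply: (@fin_all_exists _ _ (fun i n => ev (y i) c = gamma ^+ n)) => i.
    have := sym_value p_pr p_odd two_prim L_frob symc (yp i); rewrite -m1 exprSr => cm.
    have cm1 : ev (y i) c ^+ m = 1 by apply: (mulIf (nzc _ (yp i))); rewrite cm mul1r.
    by have [n ->] := prim_rootP gamma_prim cm1; exists n.
  pose g := (\prod_i z i ^+ e i)%g.
  have val_g : val g = rot c.
    rewrite val_z; apply: rot_sep => // [|i]; rewrite ev_prod.
      have := nzc 1 one_p; have /orP[/eqP->|/eqP->] := ev1_F2 L c; rewrite ?eqxx // => _.
      by rewrite big1 // => i _; have [_ -> _] := ZP i; rewrite expr1n.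
    rewrite def_e (bigD1 i) //= big1 => [|j neq_ji].
      by have [_ _ ->] := ZP i; rewrite eqxx mulr1.
    by have [_ _ ->] := ZP j; rewrite eq_sym (negPf neq_ji) expr1n.
  have Gg : g \in G.
    rewrite -(bigdprodW defG); apply/prodsgP; exists (fun i => z i ^+ e i)%g => // i _.
    exact: mem_cycle.
  rewrite -(mulgKV g u) mem_mulg //.
  exact: unitary_quotient def_u val_g symc (fun x _ => c2 x).
- apply/centsP=> u /memG[P sP def_u] v _; apply: val_inj.
  by rewrite [LHS]/= [RHS]/= def_u; apply: sym_central.
apply/trivgP/subsetP=> u /setIP[Uu /memG[P sP def_u]].
by apply/set1gP/(sym_unitary_eq1 def_u).
Qed.

End DihedralAlgebra.

Local Close Scope ring_scope.

Theorem theorem7 (p d : nat) (a b : 'D_(p.*2)) :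
  prime p -> odd p ->
  (d.-primitive_root (2%:R : 'F_p))%R ->
  (<<[set a; b]>> = [set: 'D_(p.*2)])%g ->
  (a ^+ p = 1)%g -> (b ^+ 2 = 1)%g -> (a ^ b = a^-1)%g ->
  let FD := group_algebra 'F_2 'D_(p.*2) in
  let k := if odd d then totient p %/ (2 * d) else totient p %/ d in
  let m := if odd d then 2 ^ d - 1 else 2 ^ (d %/ 2) - 1 in
  (bicyclic_group 'F_2 'D_(p.*2) ><| <[ga_unit 'F_2 b]>
     = unitary 'F_2 'D_(p.*2))%g
  /\ exists z : 'I_k -> {unit FD},
       [/\ forall i (x : FD), GRing.comm (val (z i)) x,
           forall i, #[z i]%g = m
         & (unitary 'F_2 'D_(p.*2) \x \big[dprod/1]_(i < k) <[z i]>
              = [set: {unit FD}])%g].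
Proof.
move=> p_pr p_odd two_prim gen_ab ap b2 ab FD k m.
have [L [L_frob omega]] := field_order_2X (prim_order_gt0 two_prim).
have [zeta zeta_prim] := order_two_unity_root p_pr p_odd two_prim omega.
have [w w_prim] := omega.
have card_D : #|{: 'D_(p.*2)}| = p.*2 by rewrite -cardsT card_dihedral ?prime_gt1.
have [oa b_notin] := dihedral_orders p_pr card_D gen_ab ap b2 ab.
have dih_elt := dihedral_elt gen_ab b2 ab.
split.
  exact: (unitary_sdprod p_pr p_odd oa b_notin dih_elt b2 ab two_prim L_frob zeta_prim).
have [z [cz oz prod_z]] :=
  central_units p_pr p_odd oa b_notin dih_elt b2 ab two_prim L_frob zeta_prim w_prim.
by exists z; split=> // i; rewrite oz /m /sym_degree; case: (odd d).
Qed.
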